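(* For every $n\ge 1$, $|R^s_n(\bot)|=|I_n(011,201)|$, where $R^s_n(\bot)$ is the set of strong rectangulations of size $n$ in which every vertical segment has its lower endpoint on the bottom side of the bounding rectangle.
   Context: A rectangulation of an axis-aligned rectangle $R$ is a decomposition of $R$ into finitely many interior-disjoint axis-aligned rectangles; its size is the number of rectangles. A segment is a maximal straight line segment which is a union of sides of rectangles and is not contained in the boundary of $R$; rectangulations are generic (no two segments cross). For rectangles $X,Y$: $Y$ is right of $X$ if there is a sequence $X=X_1,\dots,X_k=Y$ such that for every $i$ there is a vertical segment containing the right side of $X_i$ and the left side of $X_{i+1}$; $Y$ is above $X$ analogously with horizontal segments. Two rectangulations are strongly equivalent if there is a bijection between their rectangles preserving the left–right and above–below relations and also preserving contacts (which pairs of rectangles have boundaries sharing a segment of positive length); a strong rectangulation is a strong equivalence class. An inversion sequence of length $n$ is an integer sequence $e=(e_1,\dots,e_n)$ with $0\le e_j\le j-1$. $e$ contains a pattern $f=(f_1,\dots,f_m)$ if there are indices $i_1<\dots<i_m$ with $e_{i_a}<e_{i_b}$ iff $f_a<f_b$ and $e_{i_a}=e_{i_b}$ iff $f_a=f_b$ for all $a,b$; otherwise it avoids $f$. $I_n(011,201)$ is the set of inversion sequences of length $n$ avoiding both $011$ and $201$. *)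

(* Defs.v *)
From HB Require Import structures.
From mathcomp Require Import all_boot all_order all_algebra.
From mathcomp Require Import boolp classical_sets functions cardinality.
From mathcomp Require Import reals topology normedtype.

Set Implicit Arguments.
Unset Strict Implicit.
Unset Printing Implicit Defensive.

Import Order.TTheory GRing.Theory Num.Theory.
Import numFieldNormedType.Exports.

Local Open Scope classical_set_scope.
Local Open Scope ring_scope.

Record rectangle (R : realType) := Rectangle {
  xmin : R; xmax : R; ymin : R; ymax : R;
  xmin_lt_xmax : xmin < xmax;
  ymin_lt_ymax : ymin < ymax
}.

Definition region (R : realType) (X : rectangle R) : set (R * R) :=
  [set p | xmin X <= p.1 <= xmax X /\ ymin X <= p.2 <= ymax X].

(* {a} x [c, d] and [c, d] x {b} *)
Definition vline (R : realType) (a c d : R) : set (R * R) :=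
  [set p | p.1 = a /\ c <= p.2 <= d].

Definition hline (R : realType) (b c d : R) : set (R * R) :=
  [set p | c <= p.1 <= d /\ p.2 = b].

Definition left_side (R : realType) (X : rectangle R) :=
  vline (xmin X) (ymin X) (ymax X).
Definition right_side (R : realType) (X : rectangle R) :=
  vline (xmax X) (ymin X) (ymax X).
Definition bottom_side (R : realType) (X : rectangle R) :=
  hline (ymin X) (xmin X) (xmax X).
Definition top_side (R : realType) (X : rectangle R) :=
  hline (ymax X) (xmin X) (xmax X).

Definition sides (R : realType) (X : rectangle R) : set (set (R * R)) :=
  [set s | [\/ s = left_side X, s = right_side X,
               s = bottom_side X | s = top_side X]].

Definition boundary (R : realType) (X : rectangle R) : set (R * R) :=
  \bigcup_(s in sides X) s.

Definition vertical (R : realType) (s : set (R * R)) : Prop :=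
  exists a c d : R, c < d /\ s = vline a c d.

Definition horizontal (R : realType) (s : set (R * R)) : Prop :=
  exists b c d : R, c < d /\ s = hline b c d.

(* Straight line segments of positive length. Oblique ones are left out: they
   are never unions of sides, nor contained in the boundary of a rectangle. *)
Definition straight (R : realType) (s : set (R * R)) : Prop :=
  vertical s \/ horizontal s.

(* Labelled by 'I_n; labels are forgotten by strong equivalence below. *)
Record decomposition (R : realType) (n : nat) := Decomposition {
  outer : rectangle R;
  rect : 'I_n -> rectangle R;
  rect_cover : \bigcup_i region (rect i) = region outer;
  rect_disjoint : forall i j, i != j ->
    interior (region (rect i)) `&` interior (region (rect j)) = set0
}.

Definition union_of_sides (R : realType) (n : nat) (D : decomposition R n)
    (s : set (R * R)) : Prop :=
  exists2 S : set (set (R * R)),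
    S `<=` \bigcup_i sides (rect D i) & s = \bigcup_(t in S) t.

Definition segment (R : realType) (n : nat) (D : decomposition R n)
    (s : set (R * R)) : Prop :=
  [/\ straight s, union_of_sides D s, ~ s `<=` boundary (outer D) &
      forall t, straight t -> union_of_sides D t -> s `<=` t -> t = s].

(* A T-joint is not a crossing: the common point must be interior to both. *)
Definition generic (R : realType) (n : nat) (D : decomposition R n) : Prop :=
  forall a c d b e f : R,
    segment D (vline a c d) -> segment D (hline b e f) ->
    ~ (e < a < f /\ c < b < d).

Record rectangulation (R : realType) (n : nat) := Rectangulation {
  decomp :> decomposition R n;
  decomp_generic : generic decomp
}.

Definition right_step (R : realType) (n : nat) (D : decomposition R n)
    (i j : 'I_n) : Prop :=
  exists s, [/\ segment D s, vertical s,
    right_side (rect D i) `<=` s & left_side (rect D j) `<=` s].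

Definition above_step (R : realType) (n : nat) (D : decomposition R n)
    (i j : 'I_n) : Prop :=
  exists s, [/\ segment D s, horizontal s,
    top_side (rect D i) `<=` s & bottom_side (rect D j) `<=` s].

(* Rectangle j is right of (resp. above) rectangle i. Chains of length one are
   allowed, so both relations are reflexive. *)
Definition right_of (R : realType) (n : nat) (D : decomposition R n)
    (i j : 'I_n) : bool := connect (fun k l => `[< right_step D k l >]) i j.

Definition above (R : realType) (n : nat) (D : decomposition R n)
    (i j : 'I_n) : bool := connect (fun k l => `[< above_step D k l >]) i j.

Definition contact (R : realType) (n : nat) (D : decomposition R n)
    (i j : 'I_n) : Prop :=
  exists s, [/\ straight s, s `<=` boundary (rect D i) &
    s `<=` boundary (rect D j)].

(* The bounding rectangles of D and D' may differ. *)
Definition strong_equiv (R : realType) (n : nat)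
    (D D' : rectangulation R n) : Prop :=
  exists2 f : 'I_n -> 'I_n, bijective f &
    forall i j, [/\ right_of D i j <-> right_of D' (f i) (f j),
      above D i j <-> above D' (f i) (f j) &
      contact D i j <-> contact D' (f i) (f j)].

Definition strong_class (R : realType) (n : nat) (D : rectangulation R n) :
  set (rectangulation R n) := [set D' | strong_equiv D D'].

Definition verticals_on_bottom (R : realType) (n : nat)
    (D : decomposition R n) : Prop :=
  forall a c d : R, segment D (vline a c d) -> bottom_side (outer D) (a, c).

Definition strong_rectangulations_bot (R : realType) (n : nat) :
    set (set (rectangulation R n)) :=
  @strong_class R n @` [set D : rectangulation R n | verticals_on_bottom D].

Local Close Scope ring_scope.

(* Positions are numbered from 0, hence the bound i on the entry e_i. *)
Definition inversion_sequence (n : nat) (e : n.-tuple nat) : Prop :=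
  forall i : 'I_n, tnth e i <= i.

Definition contains_pattern (n m : nat) (e : n.-tuple nat) (f : m.-tuple nat) :
    Prop :=
  exists2 k : 'I_m -> 'I_n, (forall a b : 'I_m, a < b -> k a < k b) &
    forall a b : 'I_m,
      (tnth e (k a) < tnth e (k b) <-> tnth f a < tnth f b) /\
      (tnth e (k a) = tnth e (k b) <-> tnth f a = tnth f b).

Definition I_011_201 (n : nat) : set (n.-tuple nat) :=
  [set e | [/\ inversion_sequence e,
    ~ contains_pattern e [tuple 0; 1; 1] &
    ~ contains_pattern e [tuple 2; 0; 1]]].

Arguments strong_rectangulations_bot : clear implicits.
Arguments I_011_201 : clear implicits.

(* Main.v *)
Require Import Defs.
From mathcomp Require Import all_boot all_order all_algebra.
From mathcomp Require Import boolp classical_sets functions cardinality.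
From mathcomp Require Import reals topology normedtype.
From mathcomp Require Import zify lra.

(* When all vertical segments start on the bottom side, at most one of them lies
   on each vertical line, and the rectangles touching the bottom side (leaves)
   are ordered from left to right.  Every such rectangulation arises from a
   single rectangle by cutting leaves: horizontally, below the tops of both
   neighbouring leaves, or vertically.  Horizontal cuts in non-adjacent leaves
   commute; the cuts have a unique order in which the next cut is never more
   than one leaf to the right of the last created leaf.  If that leaf has
   number u among e leaves, the possible next cuts are one vertical cut, leading
   to (u + 1, e + 1), and the horizontal cuts of leaf i <= min (u + 1, e - 1),
   leading to (i, e).  The last cut is recovered at the leaf u preceding the
   first rise in the sequence of leaf heights, so a strong class determines its
   word of cuts.

   On the other side, an inversion sequence avoiding 011 has at most one entry
   equal to each positive value.  Inserting values in decreasing order, 1 being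
   the last, either does not use the value 1 or puts it on one of the zeros;
   avoiding 201 leaves only the first u + 2 zeros, where u + 1 is the number of
   zeros before the first positive entry.  This gives the same words. *)

Set Implicit Arguments.
Unset Strict Implicit.
Unset Printing Implicit Defensive.

Import Order.TTheory GRing.Theory Num.Theory.
Import numFieldNormedType.Exports.
(* vline is also a notion of the vector library. *)
Import Defs.

Local Open Scope nat_scope.

(** * Words and inversion sequences *)

(** A shape determines comparisons of heights only between adjacent leaves: two leaves separated by
    a higher one may exchange their heights freely. Hence the focus is defined by a rise between
    neighbours and not, for instance, as a lowest leaf. An admissible cut creates a leaf strictly
    lower than the next one and not higher than the previous one, with equality on the left exactly
    after a vertical cut. So the new leaf is the focus, and contacts tell the kind of the last cut.
    A horizontal cut of leaf [u + 1] is admissible because it destroys the rise after [u]; further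
    to the right that rise would survive and stay the first one. A vertical cut away from the focus
    also leaves the first rise where it was. Maximal segments are translated into real coordinates
    once; what remains is linear inequalities and extremal choices in finite families. *)

(* A word lists the cuts, last one first: Some i is a horizontal cut of the leaf
   number i, None a vertical cut of the focus leaf.  Its state consists of the
   number of the focus leaf and of the number of leaves.  A horizontal cut right
   of the leaf that follows the focus is forbidden: it commutes with the last
   cut, so it has to be made earlier. *)
Fixpoint state (w : seq (option nat)) : nat * nat :=
  match w with
  | [::] => (0, 1)
  | None :: w' => ((state w').1.+1, (state w').2.+1)
  | Some i :: w' => (i, (state w').2)
  end.

Fixpoint valid (w : seq (option nat)) : bool :=
  match w with
  | [::] => true
  | None :: w' => valid w'
  | Some i :: w' => [&& valid w', i <= (state w').1.+1 & i < (state w').2]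
  end.

(** Plain sequences allow a head entry to be added or removed without a change of type. The
    comparisons listed for each pattern imply its remaining ones. *)
Record good (s : seq nat) : Prop := Good {
  good_le : forall i, i < size s -> nth 0 s i <= i;
  good_011 : forall a b c, a < b -> b < c -> c < size s ->
    nth 0 s a < nth 0 s b -> nth 0 s b = nth 0 s c -> False;
  good_201 : forall a b c, a < b -> b < c -> c < size s ->
    nth 0 s b < nth 0 s c -> nth 0 s c < nth 0 s a -> False
}.

Definition raise (s : seq nat) := [seq if x == 0 then 0 else x.+1 | x <- s].

Fixpoint put (i : nat) (s : seq nat) : seq nat :=
  match s, i with
  | 0 :: s', 0 => 1 :: s'
  | 0 :: s', i'.+1 => 0 :: put i' s'
  | x :: s', _ => x :: put i s'
  | [::], _ => [::]
  end.

(* The last cut is read off the value 1: removing the first entry and lowering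
   the others by 1 (keeping zeros) gives the sequence of the remaining word.
   Zeros correspond to leaves, and lead counts those up to the focus. *)
Fixpoint decode (w : seq (option nat)) : seq nat :=
  match w with
  | [::] => [:: 0]
  | None :: w' => 0 :: raise (decode w')
  | Some i :: w' => 0 :: put i (raise (decode w'))
  end.

Definition lead (s : seq nat) := find (predC1 0) s.

Lemma nth_raise s k : nth 0 (raise s) k = if nth 0 s k == 0 then 0 else (nth 0 s k).+1.
Proof.
have [h | h] := ltnP k (size s); first by rewrite (nth_map 0).
by rewrite !nth_default ?size_map.
Qed.

Lemma count_raise s : count_mem 0 (raise s) = count_mem 0 s.
Proof. by rewrite count_map; apply: eq_count => -[]. Qed.

Lemma lead_raise s : lead (raise s) = lead s.
Proof. by rewrite /lead find_map; apply: eq_find => -[]. Qed.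

Lemma pred_raise s : map predn (raise s) = s.
Proof. by rewrite -map_comp -[RHS]map_id; apply: eq_map => -[]. Qed.

Lemma size_put i s : size (put i s) = size s.
Proof. by elim: s i => [|[|x] s IH] [|i] //=; rewrite IH. Qed.

Lemma pred_put i s : map predn (put i s) = map predn s.
Proof. by elim: s i => [|[|x] s IH] [|i] //=; rewrite IH. Qed.

Lemma count_put i s : i < count_mem 0 s ->
  (count_mem 0 (put i s)).+1 = count_mem 0 s.
Proof.
elim: s i => [|[|x] s IH] [|i] //=; rewrite ?add0n ?add1n // => h; last exact: IH.
  by rewrite IH.
exact: IH.
Qed.

Lemma lead_put i s : i < count_mem 0 s -> i <= lead s -> lead (put i s) = i.
Proof.
elim: s i => [|[|x] s IH] [|i] //=; rewrite ?add1n ?ltnS // => h1 h2.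
by congr _.+1; exact: IH.
Qed.

Lemma put_inj i j s : i < count_mem 0 s -> j < count_mem 0 s ->
  put i s = put j s -> i = j.
Proof.
elim: s i j => [|[|x] s IH] [|i] [|j] //=; rewrite ?add1n ?add0n ?ltnS //.
  by move=> h1 h2 [/IH] ->.
all: by move=> h1 h2 [/IH] ->.
Qed.

Lemma putE p s : p < size s -> nth 0 s p = 0 ->
  put (count_mem 0 (take p s)) s = set_nth 0 s p 1.
Proof.
elim: s p => [|[|x] s IH] [|p] //=; rewrite ?add1n ?add0n ltnS => h1 h2;
  by rewrite IH //; case: (count_mem 0 _).
Qed.

Lemma zero_at i s : i < count_mem 0 s ->
  exists p, [/\ p < size s, nth 0 s p = 0 & count_mem 0 (take p s) = i].
Proof.
elim: s i => [|[|x] s IH] [|i] //=; rewrite ?add1n ?add0n ?ltnS.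
- by exists 0.
- by move=> /IH[p [p1 p2 p3]]; exists p.+1; split=> //=; rewrite p3.
- by move=> /IH[p [p1 p2 p3]]; exists p.+1; split=> //=; rewrite p3.
- by move=> /IH[p [p1 p2 p3]]; exists p.+1; split=> //=; rewrite p3.
Qed.

Lemma good_head s : good s -> nth 0 s 0 = 0.
Proof. by case: s => // x s [/(_ 0 isT)]; rewrite leqn0 => /eqP. Qed.

(* A zero at p may become the new 1 exactly when no zero between a positive
   entry and p is skipped; counting zeros, this bounds its rank by lead s. *)
Lemma count_take_lead p s : p < size s -> nth 0 s p = 0 ->
  (count_mem 0 (take p s) <= lead s) <->
  (forall a b, a < b -> b < p -> 0 < nth 0 s a -> nth 0 s b = 0 -> False).
Proof.
elim: s p => [|[|x] s IH] [|p] //=; rewrite ?add1n ?add0n ltnS => h1 h2.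
- rewrite ltnS (IH p h1 h2); split=> h a b; last exact: (h a.+1 b.+1).
  by case: a b => [|a] [|b] //=; exact: (h a b).
- rewrite leqNgt -has_count; split=> [/hasPn h a b _ bp _ b0 | h].
    case: b bp b0 => // b bp /= b0; have := h (nth 0 s b).
    rewrite b0 /= => /(_ _)/negP[] //; rewrite -b0.
    by rewrite -(nth_take 0 (n0 := p)) // mem_nth // size_take h1.
  apply/hasPn => y /(nthP 0)[b]; rewrite size_take h1 => bp <-.
  rewrite nth_take //=; apply/eqP => b0; exact: (h 0 b.+1).
Qed.

(** Raising keeps the relative order of the entries, and the shift by one position makes room for
    the larger values. A pattern 011 starting at the new 0 is already present in [s], whose own head
    is 0. *)
Lemma good_cons0_raise s : good s -> good (0 :: raise s).
Proof.
move=> g; have s0 := good_head g; split=> [[|i] //= | a b c | a b c].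
- rewrite size_map ltnS nth_raise => h; have := good_le g h; case: eqP => //; lia.
- case: a b c => [|a] [|b] [|c] //=; rewrite ?ltnS size_map !nth_raise.
    move=> _ bc cs; case: eqP => // b0 _; case: eqP => // _ [E].
    have b1 : 0 < b by case: b b0 {bc E} => //; rewrite s0.
    by apply: (good_011 g b1 bc cs _ E); rewrite s0; lia.
  move=> ab bc cs h E.
  apply: (good_011 g ab bc cs); move: h E; do 3?case: eqP; lia.
- case: a b c => [|a] [|b] [|c] //=; rewrite ?ltnS size_map !nth_raise // => ab bc cs h E.
  apply: (good_201 g ab bc cs); move: h E; do 3?case: eqP; lia.
Qed.

(** The new 1 is the smallest positive value and occurs once. In a pattern 201 it cannot be the
    largest entry; as the smallest one it stands on a zero that already gave a pattern in [s]; as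
    the last one it needs a positive entry and then a zero before it, which [i <= lead s]
    forbids. *)
Lemma good_cons0_put i s : good s -> i < count_mem 0 s -> i <= lead s ->
  good (0 :: put i (raise s)).
Proof.
move=> g ic il; have s0 := good_head g.
have [p [p1 p2 pi]] := zero_at ic.
have rp : nth 0 (raise s) p = 0 by rewrite nth_raise p2.
have -> : put i (raise s) = set_nth 0 (raise s) p 1.
  rewrite -putE ?size_map //; congr (put _ _).
  by rewrite -map_take count_raise pi.
have noskip := (count_take_lead p1 p2).1; rewrite pi in noskip.
have {}noskip := noskip il.
have sz : size (set_nth 0 (raise s) p 1) = size s.
  by rewrite size_set_nth size_map; apply/maxn_idPr.
have nthE k : nth 0 (set_nth 0 (raise s) p 1) k =
    if k == p then 1 else if nth 0 s k == 0 then 0 else (nth 0 s k).+1.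
  by rewrite nth_set_nth /=; case: eqP => // _; rewrite nth_raise.
split=> [[|k] //= | a b c | a b c].
- rewrite sz ltnS nthE => h; have := good_le g h; do 2?case: eqP => //; lia.
- case: a b c => [|a] [|b] [|c] //=; rewrite ?ltnS sz !nthE.
    move=> _ bc cs; have [Eb | bp] := eqVneq b p.
      have [Ec | cp] := eqVneq c p; first by lia.
      by case: eqP; lia.
    case: eqP => // b0 _; have [Ec | cp] := eqVneq c p; first by lia.
    case: eqP => // c0 [E].
    have b1 : 0 < b by case: b b0 {bc E bp} => //; rewrite s0.
    by apply: (good_011 g b1 bc cs _ E); rewrite s0; lia.
  move=> ab bc cs; have [Eb | bp] := eqVneq b p; have [Ec | cp] := eqVneq c p;
    try by lia.
  + by case: (nth 0 s c =P 0); lia.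
  + by case: (nth 0 s b =P 0); lia.
  case: (nth 0 s b =P 0) => [|b0]; first by lia.
  move=> _; case: eqP => // c0 [E].
  have b1 : 0 < b by lia.
  by apply: (good_011 g b1 bc cs _ E); rewrite s0; lia.
- case: a b c => [|a] [|b] [|c] //=; rewrite ?ltnS sz !nthE // => ab bc cs.
  have [Ec | cp] := eqVneq c p.
    have [Eb | bp] := eqVneq b p; first by lia.
    have [Ea | ap] := eqVneq a p; first by lia.
    case: (nth 0 s b =P 0) => // b0 _; case: eqP => // a0 _.
    apply: (noskip a b) => //; last by lia.
    by rewrite ltn_neqAle bp; lia.
  have [Eb | bp] := eqVneq b p.
    have [Ea | ap] := eqVneq a p; first by lia.
    rewrite Eb in ab bc *; case: (nth 0 s c =P 0) => // c0 _; case: eqP => // a0 h.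
    by apply: (good_201 g ab bc cs); rewrite ?p2; lia.
  have [Ea | ap] := eqVneq a p; first by do 2?case: eqP; lia.
  move=> h1 h2; apply: (good_201 g ab bc cs); move: h1 h2; do 3?case: eqP; lia.
Qed.

(** A good sequence starts with 0, so [lead] is positive and its predecessor loses nothing: the
    bound by the focus plus one in [valid] becomes the bound by [lead] in [good_cons0_put]. *)
Lemma decode_valid w : valid w ->
  [/\ size (decode w) = (size w).+1, good (decode w) &
    state w = ((lead (decode w)).-1, count_mem 0 (decode w))].
Proof.
elim: w => [_ | [i|] w IH] /=.
- split=> //; split=> [[]|a b c|a b c] //=; case: c => //; lia.
- move=> /and3P[vw il ic]; have [sz g st] := IH vw.
  have lead_gt0 : 0 < lead (decode w).
    by move: sz (good_head g); rewrite /lead; case: (decode w) => //= x s _ ->.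
  rewrite st /= prednK // in il; rewrite st /= in ic.
  split; first by rewrite size_put size_map sz.
    exact: good_cons0_put.
  have h := @count_put i (raise (decode w)); rewrite count_raise in h.
  rewrite st /= -(h ic) add1n; congr (_, _).
  by rewrite -/(lead _) lead_put ?count_raise ?lead_raise.
- move=> vw; have [sz g st] := IH vw; split; first by rewrite size_map sz.
    exact: good_cons0_raise.
  rewrite st /= -/(lead _) lead_raise count_raise add1n; congr (_, _).
  by move: sz (good_head g); rewrite /lead; case: (decode w) => //= x s _ ->.
Qed.

(** Dropping the head and lowering the rest undoes a letter of either kind. The two kinds differ in
    the number of zeros, and the index of a horizontal cut is recovered by [put_inj]. *)
Lemma decode_inj w1 w2 : valid w1 -> valid w2 -> decode w1 = decode w2 -> w1 = w2.
Proof.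
move=> v1 v2 E; have [sz1 _ _] := decode_valid v1; have [sz2 _ _] := decode_valid v2.
have sz : size w1 = size w2 by apply: succn_inj; rewrite -sz1 -sz2 E.
elim: w1 w2 sz v1 v2 E {sz1 sz2} => [|a w1 IH] [|b w2] // [sz] v1 v2 E.
have u1 : valid w1 by case: a v1 {E} => [i /and3P[]|].
have u2 : valid w2 by case: b v2 {E} => [i /and3P[]|].
have tail c w : map predn (behead (decode (c :: w))) = decode w.
  by case: c => [i|] /=; rewrite ?pred_put pred_raise.
have Ew : w1 = w2 by apply: IH => //; rewrite -(tail a w1) -(tail b w2) E.
rewrite -Ew {w2 Ew sz u2} in v2 E *; congr (_ :: _).
have [_ _ st] := decode_valid u1.
case: a b v1 v2 E => [i|] [j|] //=; rewrite st /=.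
- by move=> /and3P[_ _ hi] /and3P[_ _ hj] [/put_inj ->] //; rewrite count_raise.
- move=> /and3P[_ _ hi] _ [E]; have := @count_put i (raise (decode w1)).
  by rewrite E count_raise => /(_ hi); lia.
- move=> _ /and3P[_ _ hi] [E]; have := @count_put j (raise (decode w1)).
  by rewrite -E count_raise => /(_ hi); lia.
Qed.

Lemma good_pred s : good (0 :: s) -> good (map predn s).
Proof.
move=> g; have nthE k : nth 0 (map predn s) k = (nth 0 s k).-1.
  have [h | h] := ltnP k (size s); first by rewrite (nth_map 0).
  by rewrite !nth_default ?size_map.
split=> [i | a b c ab bc | a b c ab bc]; rewrite size_map !nthE.
- by move=> h; have := good_le g (i := i.+1) h => /=; lia.
- move=> cs h1 h2; apply: (good_011 g (a := 0) (b := b.+1) (c := c.+1)) => //=; lia.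
- move=> cs h1 h2; apply: (good_201 g (a := a.+1) (b := b.+1) (c := c.+1)) => //=; lia.
Qed.

Lemma decode_onto n s : size s = n.+1 -> good s ->
  exists w, [/\ size w = n, valid w & decode w = s].
Proof.
elim: n s => [|n IH] [|x s] // [sz] g; have /= x0 := good_head g; rewrite x0 in g *.
  by move/eqP: sz; rewrite size_eq0 => /eqP ->; exists [::].
have gp := good_pred g; have [w [szw vw dw]] := IH _ (etrans (size_map _ _) sz) gp.
have [_ _ st] := decode_valid vw; rewrite dw in st.
have nthE k : nth 0 (raise (map predn s)) k = if nth 0 s k == 1 then 0 else nth 0 s k.
  rewrite nth_raise; have [h | h] := ltnP k (size s).
    by rewrite (nth_map 0) //; case: (nth 0 s k) => [|[|m]].
  by rewrite !nth_default ?size_map.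
have [s1 | s1] := boolP (1 \in s); last first.
  exists (None :: w); split=> //=; first by rewrite szw.
  rewrite dw; congr (_ :: _); apply: (@eq_from_nth _ 0); first by rewrite !size_map.
  move=> k; rewrite !size_map => h; rewrite nthE; case: eqP => // E.
  by rewrite -E mem_nth in s1.
pose p := index 1 s; have ps : p < size s by rewrite index_mem.
have sp : nth 0 s p = 1 by rewrite nth_index.
(* Two entries equal to 1 would form a pattern 011 with the leading 0. *)
have uniq1 k : k < size s -> nth 0 s k = 1 -> k = p.
  move=> ks sk; case: (ltngtP k p) => // h; exfalso.
    by apply: (good_011 g (a := 0) (b := k.+1) (c := p.+1)) => //=; rewrite ?sp ?sk.
  by apply: (good_011 g (a := 0) (b := p.+1) (c := k.+1)) => //=; rewrite ?sp ?sk.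
set s' := map predn s in dw gp nthE st *.
have szs' : size s' = size s by rewrite size_map.
have s'p : nth 0 s' p = 0 by rewrite (nth_map 0) // sp.
have ps' : p < size s' by rewrite szs'.
have s'E k : k < size s -> nth 0 s' k = (nth 0 s k).-1 by move=> h; rewrite (nth_map 0).
pose i := count_mem 0 (take p s').
have ic : i < count_mem 0 s'.
  rewrite /i -[X in _ < count_mem 0 X](cat_take_drop p) count_cat.
  by rewrite (drop_nth 0) //= s'p eqxx; lia.
(* A positive entry of [s'], a zero of [s'] after it and the position [p] carry in [s] a value at
   least 2, the value 0 and the value 1: a pattern 201. *)
have il : i <= lead s'.
  apply/(count_take_lead ps' s'p) => a b ab bp a0 b0.
  have bs : b < size s by lia.
  have as' : a < size s by lia.
  rewrite s'E // in a0; rewrite s'E // in b0.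
  have b1 : nth 0 s b <> 1 by move=> /(uniq1 b bs); lia.
  by apply: (good_201 g (a := a.+1) (b := b.+1) (c := p.+1)) => //=; rewrite sp; lia.
have lead_gt0 : 0 < lead s'.
  by move: szs' ps' (good_head gp); rewrite /lead sz; case: (s') => //= y t _ _ ->.
exists (Some i :: w); split=> //=; first by rewrite szw.
  by rewrite vw st /= ic prednK // il.
rewrite dw; congr (_ :: _); have -> : i = count_mem 0 (take p (raise s')).
  by rewrite -map_take count_raise.
rewrite putE; last 2 first.
- by rewrite size_map.
- by rewrite nthE sp.
apply: (@eq_from_nth _ 0); first by rewrite size_set_nth !size_map; exact/maxn_idPr.
move=> k; rewrite size_set_nth !size_map => h; rewrite nth_set_nth /= nthE.
case: eqP => [-> // | kp]; case: eqP => // /uniq1 E; case: kp; apply: E; lia.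
Qed.

Lemma I_011_201P n (e : n.-tuple nat) : I_011_201 n e <-> good e.
Proof.
have nthE (i : 'I_n) : nth 0 e i = tnth e i by rewrite (tnth_nth 0).
have contains f0 f1 f2 a b c : a < b -> b < c -> c < n ->
    (forall x y z : nat, [/\ nth 0 e a = x, nth 0 e b = y & nth 0 e c = z] ->
      [/\ (x < y) = (f0 < f1), (y < x) = (f1 < f0), (x < z) = (f0 < f2),
      (z < x) = (f2 < f0) & (y < z) = (f1 < f2)] /\ (z < y) = (f2 < f1)) ->
    contains_pattern e [tuple f0; f1; f2].
  move=> ab bc cn h; have bn : b < n by lia.
  have an : a < n by lia.
  have [[h1 h2 h3 h4 h5] h6] := h _ _ _ (And3 erefl erefl erefl).
  pose k (i : 'I_3) := nth (Ordinal an) [:: Ordinal an; Ordinal bn; Ordinal cn] i.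
  exists k.
    by case=> [[|[|[|?]]] ?] // [[|[|[|?]]] ?] //= _; lia.
  case=> [[|[|[|?]]] ?] // [[|[|[|?]]] ?] //=; rewrite -!nthE !(tnth_nth 0) /=; lia.
have extract f0 f1 f2 : contains_pattern e [tuple f0; f1; f2] ->
    exists a b c, [/\ a < b, b < c & c < n] /\
      [/\ nth 0 e a < nth 0 e b <-> f0 < f1, nth 0 e b < nth 0 e c <-> f1 < f2,
        nth 0 e c < nth 0 e a <-> f2 < f0 & nth 0 e b = nth 0 e c <-> f1 = f2].
  case=> k km h; pose i0 := @Ordinal 3 0 isT; pose i1 := @Ordinal 3 1 isT.
  pose i2 := @Ordinal 3 2 isT.
  exists (k i0), (k i1), (k i2); split; first by split=> //; apply: km.
  have [h01 _] := h i0 i1; have [h12 e12] := h i1 i2; have [h20 _] := h i2 i0.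
  by rewrite !nthE; move: h01 h12 e12 h20; rewrite !(tnth_nth 0 [tuple _; _; _]).
split=> [[inv no1 no2] | g].
  split; rewrite size_tuple.
  - by move=> i h; have := inv (Ordinal h); rewrite -nthE.
  - move=> a b c ab bc cn h1 h2; apply: no1; apply: (contains _ _ _ a b c) => //.
    by move=> x y z [<- <- <-]; split; [split|]; lia.
  - move=> a b c ab bc cn h1 h2; apply: no2; apply: (contains _ _ _ a b c) => //.
    by move=> x y z [<- <- <-]; split; [split|]; lia.
split=> [i | /extract | /extract].
- by rewrite -nthE; apply: (good_le g); rewrite size_tuple.
- move=> [a [b [c [[ab bc cn] [h1 h2 h3 h4]]]]].
  by apply: (good_011 g ab bc); rewrite ?size_tuple //; [apply/h1 | apply/h4].
- move=> [a [b [c [[ab bc cn] [h1 h2 h3 h4]]]]].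
  by apply: (good_201 g ab bc); rewrite ?size_tuple //; [apply/h2 | apply/h3].
Qed.

(** * Rectangulations in coordinates *)

Local Open Scope ring_scope.

(* Rectangulations with all vertical segments on the bottom side, in
   coordinates.  The cover is by half-open rectangles, hence exact; the wall
   conditions say that nothing straddles the line below a vertical side; the
   last one excludes crossings. *)
Record bottomed (R : realType) (n : nat) (O : rectangle R)
    (X : 'I_n -> rectangle R) : Prop := Bottomed {
  bottomed_xmin : forall i, xmin O <= xmin (X i);
  bottomed_xmax : forall i, xmax (X i) <= xmax O;
  bottomed_ymin : forall i, ymin O <= ymin (X i);
  bottomed_ymax : forall i, ymax (X i) <= ymax O;
  bottomed_apart : forall i j, xmin (X i) < xmax (X j) ->
    xmin (X j) < xmax (X i) -> ymin (X i) < ymax (X j) ->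
    ymin (X j) < ymax (X i) -> i = j;
  bottomed_cover : forall x y, xmin O <= x < xmax O -> ymin O <= y < ymax O ->
    exists i, xmin (X i) <= x < xmax (X i) /\ ymin (X i) <= y < ymax (X i);
  bottomed_wall_min : forall i j, xmin (X j) < xmin (X i) ->
    xmin (X i) < xmax (X j) -> ymax (X i) <= ymin (X j);
  bottomed_wall_max : forall i j, xmin (X j) < xmax (X i) ->
    xmax (X i) < xmax (X j) -> ymax (X i) <= ymin (X j);
  bottomed_nocross : forall i j, xmax (X i) = xmin (X j) ->
    ymin (X i) = ymin (X j) -> ymin (X i) = ymin O
}.

(** A vertical side of the upper rectangle strictly inside the width of the lower one would continue
    downwards as a wall through the lower one. *)
Lemma bottomed_below (R : realType) n (O : rectangle R) (X : 'I_n -> rectangle R)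
    (tX : bottomed O X) i j :
  ymax (X j) <= ymin (X i) -> xmin (X j) < xmax (X i) ->
  xmin (X i) < xmax (X j) -> xmin (X i) <= xmin (X j) /\ xmax (X j) <= xmax (X i).
Proof.
move=> tb l1 l2; have [yi yj] := (ymin_lt_ymax (X i), ymin_lt_ymax (X j)).
split; rewrite leNgt; apply/negP => h.
  by have := bottomed_wall_min tX h l2; lra.
by have := bottomed_wall_max tX l1 h; lra.
Qed.

Lemma bottomed_right_neighbour (R : realType) n (O : rectangle R)
    (X : 'I_n -> rectangle R) (tX : bottomed O X) i y :
  xmax (X i) < xmax O -> ymin O <= y < ymax (X i) ->
  exists j, xmin (X j) = xmax (X i) /\ ymin (X j) <= y < ymax (X j).
Proof.
move=> hr hy; have hl := bottomed_xmin tX i; have hw := xmin_lt_xmax (X i).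
have ht := bottomed_ymax tX i.
have [||j [jx jy]] := @bottomed_cover _ _ _ _ tX (xmax (X i)) y; try lra.
exists j; split=> //; apply/eqP; rewrite eq_le; apply/andP; split; first by lra.
rewrite leNgt; apply/negP => h.
by have := bottomed_wall_max tX h; lra.
Qed.

(** The cover is open on the right, so it cannot be queried at the left side itself. The neighbour
    is the rectangle at height [y] that starts last among those starting left of [X i]; a gap after
    it would be covered by one starting even later. *)
Lemma bottomed_left_neighbour (R : realType) n (O : rectangle R)
    (X : 'I_n -> rectangle R) (tX : bottomed O X) i y :
  xmin O < xmin (X i) -> ymin O <= y < ymax (X i) ->
  exists j, xmax (X j) = xmin (X i) /\ ymin (X j) <= y < ymax (X j).
Proof.
move=> hl hy; have hr := bottomed_xmax tX i; have hw := xmin_lt_xmax (X i).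
have ht := bottomed_ymax tX i.
have [||k0 [k0x k0y]] := @bottomed_cover _ _ _ _ tX (xmin O) y; try lra.
pose P k := [&& xmin (X k) < xmin (X i), ymin (X k) <= y & y < ymax (X k)].
have Pk0 : P k0 by rewrite /P; apply/and3P; split; lra.
case: (@arg_maxP _ _ _ k0 P (fun k => xmin (X k)) Pk0) => k /and3P[k1 k2 k3] kmax.
have kw := xmin_lt_xmax (X k).
exists k; split; last by rewrite k2.
apply/eqP; rewrite eq_le; apply/andP; split; rewrite leNgt; apply/negP => h.
  by have := bottomed_wall_min tX k1 h; lra.
have kl := bottomed_xmin tX k.
have [||m [mx my]] := @bottomed_cover _ _ _ _ tX (xmax (X k)) y; try lra.
have Pm : P m by rewrite /P; apply/and3P; split; lra.
have mk : xmin (X m) <= xmin (X k) := kmax _ Pm.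
have E : k = m by apply: (bottomed_apart tX); lra.
by rewrite E in mx; lra.
Qed.

(** The rectangle just above the upper left corner already spans the whole top side, because walls
    force it to contain the width of what lies below it. *)
Lemma bottomed_parent (R : realType) n (O : rectangle R)
    (X : 'I_n -> rectangle R) (tX : bottomed O X) i :
  ymax (X i) < ymax O ->
  exists p, [/\ ymin (X p) = ymax (X i), xmin (X p) <= xmin (X i) &
    xmax (X i) <= xmax (X p)].
Proof.
move=> ht; have hl := bottomed_xmin tX i; have hr := bottomed_xmax tX i.
have hb := bottomed_ymin tX i.
have hw := xmin_lt_xmax (X i); have hh := ymin_lt_ymax (X i).
have [||p [px py]] := @bottomed_cover _ _ _ _ tX (xmin (X i)) (ymax (X i)); try lra.
have pb : ymax (X i) <= ymin (X p).
  rewrite leNgt; apply/negP => h.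
  have E : i = p by apply: (bottomed_apart tX); lra.
  by rewrite E in py; lra.
have [||pl pr] := @bottomed_below _ _ _ _ tX p i pb; try lra.
by exists p; split=> //; lra.
Qed.

(** The cover is open at the top, so the rectangle below a floor is found as the one with the
    highest floor among those starting lower on the line of the left side. *)
Lemma bottomed_child (R : realType) n (O : rectangle R)
    (X : 'I_n -> rectangle R) (tX : bottomed O X) i :
  ymin O < ymin (X i) ->
  exists k, [/\ ymax (X k) = ymin (X i), xmin (X i) <= xmin (X k) &
    xmax (X k) <= xmax (X i)].
Proof.
move=> ht; have hl := bottomed_xmin tX i; have hr := bottomed_xmax tX i.
have hb := bottomed_ymax tX i.
have hw := xmin_lt_xmax (X i); have hh := ymin_lt_ymax (X i).
have [||k0 [k0x k0y]] := @bottomed_cover _ _ _ _ tX (xmin (X i)) (ymin O); try lra.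
pose P k := [&& ymin (X k) < ymin (X i), xmin (X k) <= xmin (X i)
  & xmin (X i) < xmax (X k)].
have Pk0 : P k0 by rewrite /P; apply/and3P; split; lra.
case: (@arg_maxP _ _ _ k0 P (fun k => ymin (X k)) Pk0) => k /and3P[k1 k2 k3] kmax.
have kw := xmin_lt_xmax (X k); have kh := ymin_lt_ymax (X k).
have kb := bottomed_ymin tX k.
have E1 : ymax (X k) <= ymin (X i).
  rewrite leNgt; apply/negP => h.
  have E : k = i by apply: (bottomed_apart tX); lra.
  by rewrite E in k1; lra.
have E2 : ymin (X i) <= ymax (X k).
  rewrite leNgt; apply/negP => h.
  have [||m [mx my]] := @bottomed_cover _ _ _ _ tX (xmin (X i)) (ymax (X k)); try lra.
  have Pm : P m by rewrite /P; apply/and3P; split; lra.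
  have mk : ymin (X m) <= ymin (X k) := kmax _ Pm.
  have E : k = m by apply: (bottomed_apart tX); lra.
  by rewrite E in my; lra.
have [||kl kr] := @bottomed_below _ _ _ _ tX i k E1; try lra.
by exists k; split=> //; lra.
Qed.

(** * Order relations, leaves and maps preserving the shape *)

Ltac bounds X i := have := xmin_lt_xmax (X i); have := ymin_lt_ymax (X i).

(** Together with [under] and [abut], the coordinate forms of [right_of] and [above] without their
    reflexive pairs, and of a contact along a vertical line. *)
Definition left_of (R : realType) n (X : 'I_n -> rectangle R) (i j : 'I_n) :=
  xmax (X i) <= xmin (X j).

Definition under (R : realType) n (X : 'I_n -> rectangle R) (i j : 'I_n) :=
  [&& ymax (X i) <= ymin (X j), xmin (X j) <= xmin (X i)
    & xmax (X i) <= xmax (X j)].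

Definition abut (R : realType) n (X : 'I_n -> rectangle R) (i j : 'I_n) :=
  [&& xmax (X i) == xmin (X j), ymin (X i) < ymax (X j)
    & ymin (X j) < ymax (X i)].

Definition leaf (R : realType) n (O : rectangle R) (X : 'I_n -> rectangle R)
  (i : 'I_n) := ymin (X i) == ymin O.

(** Strong equivalence in coordinates. Contacts along horizontal lines need no field of their own:
    they are the covering pairs of [under]. Injectivity suffices since the index set is finite. *)
Record same_shape (R : realType) n (X X' : 'I_n -> rectangle R)
    (f : 'I_n -> 'I_n) : Prop := SameShape {
  same_inj : injective f;
  same_left_of : forall i j, left_of X' (f i) (f j) = left_of X i j;
  same_under : forall i j, under X' (f i) (f j) = under X i j;
  same_abut : forall i j, abut X' (f i) (f j) = abut X i j
}.

Lemma same_shape_surj (R : realType) n (X X' : 'I_n -> rectangle R) f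
  (s : same_shape X X' f) j : exists i, f i = j.
Proof. by exists (invF (same_inj s) j); rewrite f_invF. Qed.

Lemma left_ofxx (R : realType) n (X : 'I_n -> rectangle R) i :
  left_of X i i = false.
Proof. by apply/negbTE; rewrite -ltNge xmin_lt_xmax. Qed.

Lemma leafPn (R : realType) n (O : rectangle R) (X : 'I_n -> rectangle R)
    (tX : bottomed O X) i :
  reflect (exists k, under X k i) (~~ leaf O X i).
Proof.
apply: (iffP idP) => [li | [k /and3P[k1 k2 k3]]].
  have h : ymin O < ymin (X i) by rewrite lt_neqAle eq_sym li (bottomed_ymin tX).
  have [k [k1 k2 k3]] := bottomed_child tX h.
  by exists k; apply/and3P; split; lra.
apply/eqP => h; have := bottomed_ymin tX k; have := ymin_lt_ymax (X k).
by lra.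
Qed.

Lemma leaf_eq (R : realType) n (O : rectangle R) (X : 'I_n -> rectangle R)
    (tX : bottomed O X) i j : leaf O X i -> leaf O X j ->
  xmin (X i) < xmax (X j) -> xmin (X j) < xmax (X i) -> i = j.
Proof.
move=> /eqP hi /eqP hj h1 h2.
have hi' := ymin_lt_ymax (X i); have hj' := ymin_lt_ymax (X j).
by apply: (bottomed_apart tX); lra.
Qed.

Lemma leaf_total (R : realType) n (O : rectangle R) (X : 'I_n -> rectangle R)
    (tX : bottomed O X) i j : leaf O X i -> leaf O X j ->
  [\/ i = j, xmax (X i) <= xmin (X j) | xmax (X j) <= xmin (X i)].
Proof.
move=> hi hj.
have [h1|h1] := leP (xmax (X j)) (xmin (X i)); first by constructor 3.
have [h2|h2] := leP (xmax (X i)) (xmin (X j)); first by constructor 2.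
by constructor 1; apply: (leaf_eq tX).
Qed.

(** The right side of [X i] extends as a wall to the bottom, where a leaf starts on its line. *)
Lemma leaf_right (R : realType) n (O : rectangle R) (X : 'I_n -> rectangle R)
    (tX : bottomed O X) i : xmax (X i) < xmax O ->
  exists2 m, leaf O X m & xmax (X i) = xmin (X m).
Proof.
move=> h; have hi := ymin_lt_ymax (X i); have bi := bottomed_ymin tX i.
have [|m [m1 m2]] := @bottomed_right_neighbour _ _ _ _ tX i (ymin O) h; first lra.
by exists m => //; rewrite /leaf eq_le (bottomed_ymin tX) andbT; lra.
Qed.

Lemma leaf_left (R : realType) n (O : rectangle R) (X : 'I_n -> rectangle R)
    (tX : bottomed O X) i : xmin O < xmin (X i) ->
  exists2 m, leaf O X m & xmax (X m) = xmin (X i).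
Proof.
move=> h; have hi := ymin_lt_ymax (X i); have bi := bottomed_ymin tX i.
have [|m [m1 m2]] := @bottomed_left_neighbour _ _ _ _ tX i (ymin O) h; first lra.
by exists m => //; rewrite /leaf eq_le (bottomed_ymin tX) andbT; lra.
Qed.

(* Comparing the heights of adjacent leaves is a matter of contacts: the higher
   one touches the rectangle above the lower one. *)
Lemma leaf_rise (R : realType) n (O : rectangle R) (X : 'I_n -> rectangle R)
    (tX : bottomed O X) k m : leaf O X k -> leaf O X m ->
  xmax (X k) = xmin (X m) ->
  (ymax (X k) < ymax (X m)) = [exists p, abut X p m && under X k p].
Proof.
move=> /eqP lk /eqP lm E; apply/idP/existsP => [h | [p]].
  have [|p [p1 p2 p3]] := @bottomed_parent _ _ _ _ tX k.
    by have := bottomed_ymax tX m; lra.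
  have hm := ymin_lt_ymax (X m); have hp := ymin_lt_ymax (X p).
  have hk := ymin_lt_ymax (X k).
  have wm := xmin_lt_xmax (X m); have wk := xmin_lt_xmax (X k).
  have E2 : xmax (X p) = xmax (X k).
    apply/eqP; rewrite eq_le p3 andbT leNgt; apply/negP => h'.
    have := @bottomed_wall_min _ _ _ _ tX m p; lra.
  by exists p; apply/andP; split; apply/and3P; split; rewrite ?E2 ?E //; lra.
move=> /andP[/and3P[_ p2 _] /and3P[p3 _ _]].
by lra.
Qed.

Lemma leaf_fall (R : realType) n (O : rectangle R) (X : 'I_n -> rectangle R)
    (tX : bottomed O X) k m : leaf O X k -> leaf O X m ->
  xmax (X k) = xmin (X m) ->
  (ymax (X m) < ymax (X k)) = [exists p, abut X k p && under X m p].
Proof.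
move=> /eqP lk /eqP lm E; apply/idP/existsP => [h | [p]].
  have [|p [p1 p2 p3]] := @bottomed_parent _ _ _ _ tX m.
    by have := bottomed_ymax tX k; lra.
  have hm := ymin_lt_ymax (X m); have hp := ymin_lt_ymax (X p).
  have hk := ymin_lt_ymax (X k).
  have wm := xmin_lt_xmax (X m); have wk := xmin_lt_xmax (X k).
  have E2 : xmin (X p) = xmin (X m).
    apply/eqP; rewrite eq_le p2 /= leNgt; apply/negP => h'.
    have := @bottomed_wall_max _ _ _ _ tX k p; lra.
  by exists p; apply/andP; split; apply/and3P; split; rewrite ?E2 ?E //; lra.
move=> /andP[/and3P[_ _ p2] /and3P[p3 _ _]].
by lra.
Qed.

Lemma leaf_adjacent (R : realType) n (O : rectangle R) (X : 'I_n -> rectangle R)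
    k m : leaf O X k -> leaf O X m ->
  abut X k m = (xmax (X k) == xmin (X m)).
Proof.
move=> /eqP lk /eqP lm; rewrite /abut.
have := ymin_lt_ymax (X k); have := ymin_lt_ymax (X m); rewrite lk lm => -> ->.
by rewrite !andbT.
Qed.

Lemma exists_same_shape (R : realType) n (X X' : 'I_n -> rectangle R) f
    (s : same_shape X X' f) (P Q : pred 'I_n) :
  (forall i, Q (f i) = P i) -> [exists i, Q i] = [exists i, P i].
Proof.
move=> PQ; apply/existsP/existsP => [[j] | [i Pi]]; last first.
  by exists (f i); rewrite PQ.
by have [i <-] := same_shape_surj s j; rewrite PQ; exists i.
Qed.

Section SameShape.
Variables (R : realType) (n : nat) (O O' : rectangle R).
Variables (X X' : 'I_n -> rectangle R) (f : 'I_n -> 'I_n).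
Hypothesis (tX : bottomed O X) (tX' : bottomed O' X').
Hypothesis s : same_shape X X' f.

Lemma same_leaf i : leaf O' X' (f i) = leaf O X i.
Proof.
apply: negb_inj; apply/(leafPn tX')/(leafPn tX) => [] [k].
  by have [k' <-] := same_shape_surj s k; rewrite (same_under s) => h; exists k'.
by move=> h; exists (f k); rewrite (same_under s).
Qed.

Lemma same_adjacent k m : leaf O X k -> leaf O X m ->
  (xmax (X' (f k)) == xmin (X' (f m))) = (xmax (X k) == xmin (X m)).
Proof.
move=> lk lm; rewrite -(leaf_adjacent lk lm) -(same_abut s).
by rewrite (@leaf_adjacent _ _ O') ?same_leaf.
Qed.

Lemma same_rise k m : leaf O X k -> leaf O X m -> xmax (X k) = xmin (X m) ->
  (ymax (X' (f k)) < ymax (X' (f m))) = (ymax (X k) < ymax (X m)).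
Proof.
move=> lk lm E; rewrite (leaf_rise tX) // (leaf_rise tX') ?same_leaf //.
  by apply: (exists_same_shape s) => i; rewrite (same_abut s) ?(same_under s).
by apply/eqP; rewrite same_adjacent // E.
Qed.

Lemma same_fall k m : leaf O X k -> leaf O X m -> xmax (X k) = xmin (X m) ->
  (ymax (X' (f m)) < ymax (X' (f k))) = (ymax (X m) < ymax (X k)).
Proof.
move=> lk lm E; rewrite (leaf_fall tX) // (leaf_fall tX') ?same_leaf //.
  by apply: (exists_same_shape s) => i; rewrite (same_abut s) ?(same_under s).
by apply/eqP; rewrite same_adjacent // E.
Qed.
End SameShape.

(* Read from left to right, the heights of the leaves weakly decrease up to the
   focus, which is followed by a strictly higher leaf or by no leaf. *)
Record focus (R : realType) n (O : rectangle R) (X : 'I_n -> rectangle R)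
    (u : 'I_n) : Prop := Focus {
  focus_leaf : leaf O X u;
  focus_before : forall k m, leaf O X k -> leaf O X m ->
    xmax (X k) = xmin (X m) -> xmax (X m) <= xmax (X u) ->
    ymax (X m) <= ymax (X k);
  focus_next : forall m, leaf O X m -> xmax (X u) = xmin (X m) ->
    ymax (X u) < ymax (X m)
}.

(** The rightmost leaf satisfies [P] vacuously, so a leftmost leaf satisfying [P] exists. A rise
    before it would start at a leaf that satisfies [P] and lies further left. *)
Lemma focus_exists (R : realType) n (O : rectangle R) (X : 'I_n -> rectangle R)
    (tX : bottomed O X) : exists u, focus O X u.
Proof.
pose P i := leaf O X i && [forall m, leaf O X m ==>
  (xmax (X i) == xmin (X m)) ==> (ymax (X i) < ymax (X m))].
have [wO hO] := (xmin_lt_xmax O, ymin_lt_ymax O).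
have [||a0 [a0x a0y]] := @bottomed_cover _ _ _ _ tX (xmin O) (ymin O); try lra.
have la0 : leaf O X a0 by rewrite /leaf eq_le (bottomed_ymin tX) andbT; lra.
case: (@arg_maxP _ _ _ a0 (leaf O X) (fun i => xmin (X i)) la0) => z lz zmax.
have Pz : P z.
  rewrite /P lz; apply/forallP => m; apply/implyP => lm; apply/implyP => /eqP E.
  have : xmin (X m) <= xmin (X z) := zmax _ lm.
  by have := xmin_lt_xmax (X z); lra.
case: (@arg_minP _ _ _ z P (fun i => xmin (X i)) Pz) => u /andP[lu nu] umin.
exists u; split=> // [k m lk lm E h | m lm E]; last first.
  by have /forallP/(_ m) := nu; rewrite lm E eqxx.
rewrite leNgt; apply/negP => rise.
have Pk : P k.
  rewrite /P lk; apply/forallP => m'; apply/implyP => lm'; apply/implyP => /eqP E'.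
  suff <- : m = m' by [].
  have := xmin_lt_xmax (X m); have := xmin_lt_xmax (X m') => ? ?.
  by apply: (leaf_eq tX) => //; lra.
have : xmin (X u) <= xmin (X k) := umin _ Pk.
have wk := xmin_lt_xmax (X k); have wm := xmin_lt_xmax (X m); move=> h2.
have Ek : k = u by apply: (leaf_eq tX) => //; lra.
by rewrite -Ek in h; lra.
Qed.

Lemma focus_uniq (R : realType) n (O : rectangle R) (X : 'I_n -> rectangle R)
    (tX : bottomed O X) u v : focus O X u -> focus O X v -> u = v.
Proof.
suff main a b : focus O X a -> focus O X b -> ~ xmax (X a) <= xmin (X b).
  move=> fu fv; case: (leaf_total tX (focus_leaf fu) (focus_leaf fv)) => // h.
    by case: (main u v).
  by case: (main v u).
move=> fa fb h.
have [|m lm E] := @leaf_right _ _ _ _ tX a.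
  have := bottomed_xmax tX b; have := xmin_lt_xmax (X b); lra.
have h1 := focus_next fa lm E.
have [wm wb] := (xmin_lt_xmax (X m), xmin_lt_xmax (X b)).
have h2 : xmax (X m) <= xmax (X b).
  by case: (leaf_total tX lm (focus_leaf fb)) => [->|h2|h2] //; lra.
have := focus_before fb (focus_leaf fa) lm E h2; lra.
Qed.

Lemma same_focus (R : realType) n (O O' : rectangle R)
    (X X' : 'I_n -> rectangle R) (f : 'I_n -> 'I_n)
    (tX : bottomed O X) (tX' : bottomed O' X') (s : same_shape X X' f) u :
  focus O X u -> focus O' X' (f u).
Proof.
move=> fu; have lu := focus_leaf fu.
(* The comparison of right ends in [focus_before] has to be rewritten with relations that [f]
   preserves. *)
have right_end (O1 : rectangle R) X1 (t1 : bottomed O1 X1) m v :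
    leaf O1 X1 m -> leaf O1 X1 v ->
    (xmax (X1 m) <= xmax (X1 v)) = (m == v) || left_of X1 m v.
  move=> lm lv; have [wm wv] := (xmin_lt_xmax (X1 m), xmin_lt_xmax (X1 v)).
  rewrite /left_of; case: (leaf_total t1 lm lv) => [-> | h | h].
  - by rewrite eqxx lexx.
  - by rewrite h orbT; lra.
  - have -> : (m == v) = false by apply/eqP => E; rewrite E in h; lra.
    by apply/idP/idP => /=; lra.
split; first by rewrite (same_leaf tX tX' s).
  move=> k' m'; have [k <-] := same_shape_surj s k'.
  have [m <-] := same_shape_surj s m'; rewrite !(same_leaf tX tX' s) => lk lm.
  move=> /eqP; rewrite (same_adjacent tX tX' s) // => /eqP E.
  rewrite (right_end _ _ _ tX') ?(same_leaf tX tX' s) // (inj_eq (same_inj s)).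
  rewrite (same_left_of s) // -(right_end _ _ _ tX) // => h.
  by rewrite leNgt (same_rise tX tX' s) // -leNgt (focus_before fu).
move=> m'; have [m <-] := same_shape_surj s m'; rewrite !(same_leaf tX tX' s) => lm.
move=> /eqP; rewrite (same_adjacent tX tX' s) // => /eqP E.
by rewrite (same_rise tX tX' s) // (focus_next fu).
Qed.

(** * Ranks of leaves *)

Definition rank (R : realType) n (O : rectangle R) (X : 'I_n -> rectangle R)
  (q : 'I_n) := (\sum_(k < n) (leaf O X k && left_of X k q))%N.

Definition nleaves (R : realType) n (O : rectangle R)
  (X : 'I_n -> rectangle R) := (\sum_(k < n) leaf O X k)%N.

Lemma same_rank (R : realType) n (O O' : rectangle R)
    (X X' : 'I_n -> rectangle R) (f : 'I_n -> 'I_n)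
    (tX : bottomed O X) (tX' : bottomed O' X') (s : same_shape X X' f) q :
  rank O' X' (f q) = rank O X q.
Proof.
rewrite /rank (reindex f) /=; last first.
  by exists (invF (same_inj s)) => i _; [exact: invF_f | exact: f_invF].
by apply: eq_bigr => k _; rewrite (same_leaf tX tX' s) (same_left_of s).
Qed.

Lemma rank_next (R : realType) n (O : rectangle R) (X : 'I_n -> rectangle R)
    (tX : bottomed O X) a b : leaf O X a -> leaf O X b ->
  xmax (X a) = xmin (X b) -> rank O X b = (rank O X a).+1.
Proof.
move=> la lb E; rewrite /rank (bigD1 a) //= [in RHS](bigD1 a) //=.
rewrite la left_ofxx /= {1}/left_of E lexx add0n add1n; congr _.+1.
apply: eq_bigr => k ka; case lk: (leaf O X k) => //=; congr nat_of_bool.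
rewrite /left_of; have [wa wb] := (xmin_lt_xmax (X a), xmin_lt_xmax (X b)).
have wk := xmin_lt_xmax (X k).
case: (leaf_total tX lk la) => [kE | h | h]; first by rewrite kE eqxx in ka.
  by rewrite h; lra.
by apply/idP/idP => h'; lra.
Qed.

Lemma rank_lt (R : realType) n (O : rectangle R) (X : 'I_n -> rectangle R) a b :
  leaf O X a -> left_of X a b -> (rank O X a < rank O X b)%N.
Proof.
move=> la ab; rewrite /rank (bigD1 a) //= [ltnRHS](bigD1 a) //=.
rewrite la left_ofxx ab /= add0n add1n ltnS.
apply: leq_sum => k _; case: (leaf O X k) => //=.
move: ab; rewrite /left_of => ab; have wa := xmin_lt_xmax (X a).
case h: (xmax (X k) <= xmin (X a)) => //.
by have -> : xmax (X k) <= xmin (X b) by lra.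
Qed.

Lemma rank_inj (R : realType) n (O : rectangle R) (X : 'I_n -> rectangle R)
    (tX : bottomed O X) a b : leaf O X a -> leaf O X b ->
  rank O X a = rank O X b -> a = b.
Proof.
move=> la lb E; case: (leaf_total tX la lb) => // h.
  by have := rank_lt la h; rewrite E ltnn.
by have := rank_lt lb h; rewrite E ltnn.
Qed.

Lemma rank_last (R : realType) n (O : rectangle R) (X : 'I_n -> rectangle R)
    (tX : bottomed O X) a : leaf O X a -> xmax (X a) = xmax O ->
  nleaves O X = (rank O X a).+1.
Proof.
move=> la E; rewrite /nleaves /rank (bigD1 a) //= [in RHS](bigD1 a) //=.
rewrite la left_ofxx /= add0n add1n; congr _.+1.
apply: eq_bigr => k ka; case lk: (leaf O X k) => //=.
case: (leaf_total tX lk la) => [kE | h | h]; first by rewrite kE eqxx in ka.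
  by rewrite /left_of h.
by exfalso; have := bottomed_xmax tX k; have := xmin_lt_xmax (X k); lra.
Qed.

Lemma rank_lt_nleaves (R : realType) n (O : rectangle R)
    (X : 'I_n -> rectangle R) a : leaf O X a -> (rank O X a < nleaves O X)%N.
Proof.
move=> la; rewrite /nleaves /rank (bigD1 a) //= [ltnRHS](bigD1 a) //=.
rewrite la left_ofxx add0n add1n ltnS.
by apply: leq_sum => k _; case: (leaf O X k) => //=; case: left_of.
Qed.

Lemma rank_onto (R : realType) n (O : rectangle R) (X : 'I_n -> rectangle R)
    (tX : bottomed O X) i : (i < nleaves O X)%N ->
  exists2 q, leaf O X q & rank O X q = i.
Proof.
elim: i => [_ | i IH h].
  have [wO hO] := (xmin_lt_xmax O, ymin_lt_ymax O).
  have [||a [ax ay]] := @bottomed_cover _ _ _ _ tX (xmin O) (ymin O); try lra.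
  exists a; first by rewrite /leaf eq_le (bottomed_ymin tX) andbT; lra.
  rewrite /rank big1 // => k _; suff -> : left_of X k a = false by rewrite andbF.
  apply/negbTE; rewrite -ltNge.
  by have := bottomed_xmin tX k; have := xmin_lt_xmax (X k); lra.
have [|q lq qi] := IH; first exact: ltnW.
have hq : xmax (X q) < xmax O.
  rewrite lt_neqAle (bottomed_xmax tX) andbT; apply/eqP => E.
  by rewrite (rank_last tX lq E) qi ltnn in h.
have [m lm E] := leaf_right tX hq.
by exists m => //; rewrite (rank_next tX lq lm E) qi.
Qed.

(** A rise onto [q] itself is tolerated: lowering [q] by a cut removes it. *)
Definition no_rise_before (R : realType) n (O : rectangle R)
    (X : 'I_n -> rectangle R) (q : 'I_n) : Prop :=
  forall k m, leaf O X k -> leaf O X m -> xmax (X k) = xmin (X m) ->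
    xmax (X m) <= xmin (X q) -> ymax (X m) <= ymax (X k).

(** The first rise leads from the focus to the leaf after it, and this second leaf lies left of [q]
    exactly when [q] has larger rank. This is the geometric meaning of the bound in [valid]. *)
Lemma no_rise_beforeP (R : realType) n (O : rectangle R)
    (X : 'I_n -> rectangle R) (tX : bottomed O X) u q :
  focus O X u -> leaf O X q ->
  no_rise_before O X q <-> (rank O X q <= (rank O X u).+1)%N.
Proof.
move=> fu lq; have lu := focus_leaf fu; split=> [nr | h k m lk lm E mq].
  case: (leaf_total tX lq lu) => [-> // | h | h].
    by apply: leqW; apply: ltnW; exact: rank_lt.
  have [|m lm E] := @leaf_right _ _ _ _ tX u.
    by have := bottomed_xmax tX q; have := xmin_lt_xmax (X q); lra.
  have hm := focus_next fu lm E; have := xmin_lt_xmax (X m).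
  have := xmin_lt_xmax (X q) => ? ?.
  case: (leaf_total tX lm lq) => [<- | h' | h']; last 2 first.
  - by have := nr _ _ lu lm E h'; lra.
  - by lra.
  by rewrite (rank_next tX lu lm E).
have [h' | h'] := leP (xmax (X m)) (xmax (X u)); first exact: (focus_before fu).
have um : left_of X u m.
  have := xmin_lt_xmax (X m); have := xmin_lt_xmax (X u); rewrite /left_of.
  by case: (leaf_total tX lm lu) => [E' | h2 | h2] //; [rewrite E' in h' | ]; lra.
by have := rank_lt lu um; have := rank_lt lm mq; lia.
Qed.

(** * Cutting and merging leaves *)

(* Rectangle r of X is cut off the bottom of leaf q of X'.  Only the tops of the
   neighbouring leaves have to stay above the cut. *)
Record hcut (R : realType) n (O : rectangle R) (X' : 'I_n -> rectangle R)
    (X : 'I_n.+1 -> rectangle R) (q : 'I_n) (r : 'I_n.+1) : Prop := Hcut {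
  hcut_leaf : ymin (X' q) = ymin O;
  hcut_xmin : forall k, xmin (X (lift r k)) = xmin (X' k);
  hcut_xmax : forall k, xmax (X (lift r k)) = xmax (X' k);
  hcut_ymax : forall k, ymax (X (lift r k)) = ymax (X' k);
  hcut_ymin : forall k, k != q -> ymin (X (lift r k)) = ymin (X' k);
  hcut_xmin_new : xmin (X r) = xmin (X' q);
  hcut_xmax_new : xmax (X r) = xmax (X' q);
  hcut_ymin_new : ymin (X r) = ymin O;
  hcut_ymax_new : ymax (X r) = ymin (X (lift r q));
  hcut_low : forall m, leaf O X' m ->
    xmax (X' m) = xmin (X' q) \/ xmax (X' q) = xmin (X' m) ->
    ymax (X r) < ymax (X' m)
}.

(** The new label [r] goes to the right half: if [q] was the focus, that half precedes the rise and
    becomes the focus. *)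
Record vcut (R : realType) n (O : rectangle R) (X' : 'I_n -> rectangle R)
    (X : 'I_n.+1 -> rectangle R) (q : 'I_n) (r : 'I_n.+1) : Prop := Vcut {
  vcut_leaf : ymin (X' q) = ymin O;
  vcut_xmin : forall k, xmin (X (lift r k)) = xmin (X' k);
  vcut_ymin : forall k, ymin (X (lift r k)) = ymin (X' k);
  vcut_ymax : forall k, ymax (X (lift r k)) = ymax (X' k);
  vcut_xmax : forall k, k != q -> xmax (X (lift r k)) = xmax (X' k);
  vcut_xmin_new : xmin (X r) = xmax (X (lift r q));
  vcut_xmax_new : xmax (X r) = xmax (X' q);
  vcut_ymin_new : ymin (X r) = ymin O;
  vcut_ymax_new : ymax (X r) = ymax (X' q)
}.

Section HCut.
Variables (R : realType) (n : nat) (O : rectangle R).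
Variables (X' : 'I_n -> rectangle R) (X : 'I_n.+1 -> rectangle R).
Variables (q : 'I_n) (r : 'I_n.+1).
Hypothesis (tX' : bottomed O X') (tX : bottomed O X) (c : hcut O X' X q r).

(** This and the following lemmas express the relations after a horizontal cut by those of [X'] and
    by [q]; the height of the cut does not occur. Shape-preserving maps can therefore be carried
    through the cut in both directions. *)
Lemma hcut_left_of k m : left_of X (lift r k) (lift r m) = left_of X' k m.
Proof. by rewrite /left_of (hcut_xmax c) (hcut_xmin c). Qed.

Lemma hcut_left_of_newl m : left_of X r (lift r m) = left_of X' q m.
Proof. by rewrite /left_of (hcut_xmax_new c) (hcut_xmin c). Qed.

Lemma hcut_left_of_newr k : left_of X (lift r k) r = left_of X' k q.
Proof. by rewrite /left_of (hcut_xmax c) (hcut_xmin_new c). Qed.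

Lemma hcut_leaf_new : leaf O X r.
Proof. by rewrite /leaf (hcut_ymin_new c). Qed.

Lemma hcut_leaf_old k : leaf O X (lift r k) = (k != q) && leaf O X' k.
Proof.
case: eqVneq => [-> | kq] /=; last by rewrite /leaf (hcut_ymin c).
apply/negbTE/eqP => E; have := ymin_lt_ymax (X r).
rewrite (hcut_ymax_new c) (hcut_ymin_new c); lra.
Qed.

Lemma hcut_under_newl m : under X r (lift r m) = (m == q) || under X' q m.
Proof.
rewrite /under (hcut_xmin c) (hcut_xmax c) (hcut_xmin_new c) (hcut_xmax_new c).
case: eqVneq => [-> | mq] /=; first by rewrite (hcut_ymax_new c) !lexx.
rewrite (hcut_ymin c) //.
have h1 := ymin_lt_ymax (X (lift r q)); rewrite -(hcut_ymax_new c) (hcut_ymax c) in h1.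
have h2 := ymin_lt_ymax (X r); rewrite (hcut_ymin_new c) in h2.
have h3 := hcut_leaf c; have wq := xmin_lt_xmax (X' q); bounds X' m => h5 h6.
apply/and3P/and3P => -[u1 u2 u3]; split=> //; last by lra.
rewrite leNgt; apply/negP => h; case/eqP: mq.
by apply: (bottomed_apart tX'); lra.
Qed.

Lemma hcut_under k m : under X (lift r k) (lift r m) = under X' k m.
Proof.
rewrite /under !(hcut_xmin c) !(hcut_xmax c) (hcut_ymax c).
case: (eqVneq m q) => [-> | mq]; last by rewrite (hcut_ymin c).
have h1 := ymin_lt_ymax (X (lift r q)); rewrite -(hcut_ymax_new c) (hcut_ymax c) in h1.
have h2 := ymin_lt_ymax (X r); rewrite (hcut_ymin_new c) in h2.
have h3 := hcut_leaf c; bounds X' k => h4 wk; have bk := bottomed_ymin tX' k.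
rewrite -(hcut_ymax_new c).
apply/and3P/and3P => -[u1 u2 u3]; last by lra.
have kq : k != q by apply/eqP => E; rewrite E in u1; lra.
have E : lift r k = r.
  apply: (bottomed_apart tX); rewrite ?(hcut_xmin c) ?(hcut_xmax c) ?(hcut_ymax c).
  - by rewrite (hcut_xmax_new c); lra.
  - by rewrite (hcut_xmin_new c); lra.
  - by rewrite (hcut_ymin c) //; lra.
  - by rewrite (hcut_ymin_new c); lra.
by have := neq_lift r k; rewrite E eqxx.
Qed.

Lemma hcut_under_newr k : under X k r = false.
Proof.
apply/negbTE/negP => h; have /negP[] := introT (leafPn tX _) (ex_intro _ k h).
by rewrite hcut_leaf_new.
Qed.

Lemma hcut_abut k m : abut X (lift r k) (lift r m) = abut X' k m.
Proof.
rewrite /abut (hcut_xmin c) (hcut_xmax c) !(hcut_ymax c).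
case: eqP => //= E.
have h1 := ymin_lt_ymax (X (lift r q)); rewrite -(hcut_ymax_new c) (hcut_ymax c) in h1.
have h2 := ymin_lt_ymax (X r); rewrite (hcut_ymin_new c) in h2.
have h3 := hcut_leaf c.
bounds X' k => hk wk; bounds X' m => hm wm.
have bk := bottomed_ymin tX' k; have bm := bottomed_ymin tX' m.
(* Every rectangle with a side on a wall of [q], seen from across, ends above the cut: the leaf [z]
   there does by [hcut_low], and any other one ending lower would overlap [z]. So raising the floor
   of [q] loses no contact. *)
have beyond p : p != q -> xmax (X' p) = xmin (X' q) \/ xmax (X' q) = xmin (X' p) ->
    ymax (X r) < ymax (X' p).
  move=> pq adj; bounds X' p => hp wp; have bp := bottomed_ymin tX' p.
  have wq := xmin_lt_xmax (X' q).
  have lq : leaf O X' q by apply/eqP.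
  case: adj => adj.
    have [|z lz zE] := @leaf_left _ _ _ _ tX' q.
      by have := bottomed_xmin tX' p; lra.
    have hz := hcut_low c lz (or_introl zE); have wz := xmin_lt_xmax (X' z).
    have [E' | zp] := eqVneq p z; first by rewrite E'.
    rewrite ltNge; apply/negP => le; case/eqP: zp.
    by apply: (bottomed_apart tX'); move/eqP: lz => lz; lra.
  have [|z lz zE] := @leaf_right _ _ _ _ tX' q.
    by have := bottomed_xmax tX' p; lra.
  have hz := hcut_low c lz (or_intror zE); have wz := xmin_lt_xmax (X' z).
  have [E' | zp] := eqVneq p z; first by rewrite E'.
  rewrite ltNge; apply/negP => le; case/eqP: zp.
  by apply: (bottomed_apart tX'); move/eqP: lz => lz; lra.
have [kq | kq] := eqVneq k q.
  have mq : m != q by apply/eqP => mq; rewrite kq mq in E wm; lra.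
  rewrite (hcut_ymin c mq) kq -(hcut_ymax_new c).
  have := beyond m mq; rewrite kq in E; move/(_ (or_intror E)) => h.
  by rewrite h h3; congr (_ && _); apply/esym; lra.
have [mq | mq] := eqVneq m q; last by rewrite !(hcut_ymin c).
rewrite (hcut_ymin c kq) mq -(hcut_ymax_new c).
have := beyond k kq; rewrite mq in E; move/(_ (or_introl E)) => h.
by rewrite h h3; congr (_ && _); apply/esym; lra.
Qed.

(** The cut lies below the top of the neighbouring leaf, so the new leaf touches nothing else across
    the wall. *)
Lemma hcut_abut_newl m : abut X r (lift r m) = leaf O X' m && abut X' q m.
Proof.
have h1 := ymin_lt_ymax (X (lift r q)); rewrite -(hcut_ymax_new c) (hcut_ymax c) in h1.
have h2 := ymin_lt_ymax (X r); rewrite (hcut_ymin_new c) in h2.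
have h3 := hcut_leaf c; bounds X' m => hm wm.
rewrite /abut (hcut_xmin c) (hcut_xmax_new c) (hcut_ymax c) (hcut_ymin_new c).
case: eqP => /= [E | _]; last by rewrite andbF.
have mq : m != q by apply/eqP => mq; rewrite mq in E wm; lra.
have bm := bottomed_ymin tX' m; have wq := xmin_lt_xmax (X' q).
rewrite (hcut_ymin c mq); apply/andP/and3P => [[u1 u2] | [/eqP u1 u2 u3]]; last by lra.
suff lm : leaf O X' m by split=> //; lra.
have [|z lz zE] := @leaf_right _ _ _ _ tX' q.
  by have := bottomed_xmax tX' m; lra.
have hz := hcut_low c lz (or_intror zE); have wz := xmin_lt_xmax (X' z).
suff -> : m = z by [].
by apply: (bottomed_apart tX'); move/eqP: lz => lz; lra.
Qed.

Lemma hcut_abut_newr k : abut X (lift r k) r = leaf O X' k && abut X' k q.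
Proof.
have h1 := ymin_lt_ymax (X (lift r q)); rewrite -(hcut_ymax_new c) (hcut_ymax c) in h1.
have h2 := ymin_lt_ymax (X r); rewrite (hcut_ymin_new c) in h2.
have h3 := hcut_leaf c; bounds X' k => hk wk.
rewrite /abut (hcut_xmax c) (hcut_xmin_new c) (hcut_ymax c) (hcut_ymin_new c).
case: eqP => /= [E | _]; last by rewrite andbF.
have kq : k != q by apply/eqP => kq; rewrite kq in E wk; lra.
have bk := bottomed_ymin tX' k; have wq := xmin_lt_xmax (X' q).
rewrite (hcut_ymin c kq); apply/andP/and3P => [[u1 u2] | [/eqP u1 u2 u3]]; last by lra.
suff lk : leaf O X' k by split=> //; lra.
have [|z lz zE] := @leaf_left _ _ _ _ tX' q.
  by have := bottomed_xmin tX' k; lra.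
have hz := hcut_low c lz (or_introl zE); have wz := xmin_lt_xmax (X' z).
suff -> : k = z by [].
by apply: (bottomed_apart tX'); move/eqP: lz => lz; lra.
Qed.

Lemma hcut_focus : no_rise_before O X' q -> focus O X r.
Proof.
move=> nr; have lq : leaf O X' q by apply/eqP; apply: hcut_leaf c.
have wr := xmin_lt_xmax (X r).
split; first exact: hcut_leaf_new.
  move=> k m; case: (unliftP r m) => [m' -> | ->].
    case: (unliftP r k) => [k' -> | ->]; rewrite !hcut_leaf_old.
      move=> /andP[kq lk] /andP[mq lm].
      rewrite !(hcut_xmin c) !(hcut_xmax c) !(hcut_ymax c) (hcut_xmax_new c) => E h.
      apply: (nr _ _ lk lm E).
      case: (leaf_total tX' lm lq) => [E' | // | h']; first by rewrite E' eqxx in mq.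
      by have := xmin_lt_xmax (X' m'); lra.
    move=> _ /andP[mq lm] E h; rewrite (hcut_xmin c) in E.
    by have := xmin_lt_xmax (X' m'); rewrite -(hcut_xmax c); lra.
  case: (unliftP r k) => [k' -> | ->]; last by lra.
  rewrite hcut_leaf_old => /andP[kq lk] _.
  rewrite (hcut_xmax c) (hcut_xmin_new c) (hcut_ymax c) => E _.
  by apply/ltW/(hcut_low c lk); left.
move=> m; case: (unliftP r m) => [m' -> | -> _]; last by lra.
rewrite hcut_leaf_old => /andP[mq lm].
rewrite (hcut_xmax_new c) (hcut_xmin c) (hcut_ymax c) => E.
by apply: (hcut_low c lm); right.
Qed.

Lemma hcut_rank : rank O X r = rank O X' q.
Proof.
rewrite /rank (bigD1_ord r) //= left_ofxx andbF add0n.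
apply: eq_bigr => k _; rewrite hcut_leaf_old hcut_left_of_newr.
by case: eqVneq => //= ->; rewrite left_ofxx andbF.
Qed.

Lemma hcut_nleaves : nleaves O X = nleaves O X'.
Proof.
rewrite /nleaves (bigD1_ord r) //= hcut_leaf_new [RHS](bigD1 q) //=.
have -> : leaf O X' q by apply/eqP; apply: hcut_leaf c.
congr addn; rewrite [RHS]big_mkcond; apply: eq_bigr => k _.
by rewrite hcut_leaf_old; case: eqVneq.
Qed.
End HCut.

Section VCut.
Variables (R : realType) (n : nat) (O : rectangle R).
Variables (X' : 'I_n -> rectangle R) (X : 'I_n.+1 -> rectangle R).
Variables (q : 'I_n) (r : 'I_n.+1).
Hypothesis (tX' : bottomed O X') (tX : bottomed O X) (c : vcut O X' X q r).

Lemma vcut_bounds : [/\ xmin (X' q) < xmax (X (lift r q)),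
  xmax (X (lift r q)) < xmax (X' q) & ymin O < ymax (X' q)].
Proof.
split.
- by rewrite -(vcut_xmin c) xmin_lt_xmax.
- by rewrite -(vcut_xmin_new c) -(vcut_xmax_new c) xmin_lt_xmax.
- by rewrite -(vcut_leaf c) ymin_lt_ymax.
Qed.

(** Since [q] stands on the bottom, anything else over its width lies above it and then spans it
    entirely. Hence the position of a vertical cut inside [q] does not affect the other
    relations. *)
Lemma leaf_over m : m != q -> xmin (X' m) < xmax (X' q) ->
  xmin (X' q) < xmax (X' m) ->
  [/\ ymax (X' q) <= ymin (X' m), xmin (X' m) <= xmin (X' q) &
    xmax (X' q) <= xmax (X' m)].
Proof.
move=> mq h1 h2.
have h : ymax (X' q) <= ymin (X' m).
  rewrite leNgt; apply/negP => h; case/eqP: mq.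
  apply: (bottomed_apart tX') => //; rewrite (vcut_leaf c).
  exact: le_lt_trans (bottomed_ymin tX' _) (ymin_lt_ymax _).
by have [] := bottomed_below tX' h h2 h1.
Qed.

Lemma vcut_left_of k m : left_of X (lift r k) (lift r m) = left_of X' k m.
Proof.
rewrite /left_of (vcut_xmin c).
have [-> | kq] := eqVneq k q; last by rewrite (vcut_xmax c).
have [h1 h2 h3] := vcut_bounds; have wm := xmin_lt_xmax (X' m).
apply/idP/idP => [h | ]; last by lra.
rewrite leNgt; apply/negP => h'.
have mq : m != q by apply/eqP => mq; rewrite mq in h; lra.
by have [| | _ h4 _] := leaf_over mq; lra.
Qed.

Lemma vcut_left_of_newl m : left_of X r (lift r m) = left_of X' q m.
Proof. by rewrite /left_of (vcut_xmax_new c) (vcut_xmin c). Qed.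

Lemma vcut_left_of_newr k : left_of X (lift r k) r = (k == q) || left_of X' k q.
Proof.
rewrite /left_of (vcut_xmin_new c).
have [-> | kq] /= := eqVneq k q; first by rewrite lexx.
rewrite (vcut_xmax c) //.
have [h1 h2 h3] := vcut_bounds; have wk := xmin_lt_xmax (X' k).
apply/idP/idP => [h | ]; last by lra.
rewrite leNgt; apply/negP => h'.
by have [| | _ _ h4] := leaf_over kq; lra.
Qed.

Lemma vcut_leaf_new : leaf O X r.
Proof. by rewrite /leaf (vcut_ymin_new c). Qed.

Lemma vcut_leaf_old k : leaf O X (lift r k) = leaf O X' k.
Proof. by rewrite /leaf (vcut_ymin c). Qed.

Lemma vcut_under k m : under X (lift r k) (lift r m) = under X' k m.
Proof.
have [h1 h2 h3] := vcut_bounds; have h4 := vcut_leaf c.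
rewrite /under !(vcut_xmin c) (vcut_ymin c) (vcut_ymax c).
have [-> | mq] := eqVneq m q.
  have hk := ymin_lt_ymax (X' k); have bk := bottomed_ymin tX' k.
  by apply/and3P/and3P => [] [u1 u2 u3]; lra.
rewrite [in LHS](vcut_xmax c mq).
have [-> | kq] := eqVneq k q; last by rewrite (vcut_xmax c).
have wm := xmin_lt_xmax (X' m).
apply/and3P/and3P => [] [u1 u2 u3]; split=> //; last by lra.
by have [| | _ _ h5] := leaf_over mq; lra.
Qed.

Lemma vcut_under_newl m : under X r (lift r m) = under X' q m.
Proof.
have [h1 h2 h3] := vcut_bounds; have h4 := vcut_leaf c.
rewrite /under !(vcut_xmin c) (vcut_ymin c) (vcut_ymax_new c) (vcut_xmin_new c).
rewrite (vcut_xmax_new c).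
have [-> | mq] := eqVneq m q.
  by apply/and3P/and3P => [] [u1 u2 u3]; lra.
rewrite (vcut_xmax c mq); have wm := xmin_lt_xmax (X' m).
apply/and3P/and3P => [] [u1 u2 u3]; split=> //; last by lra.
by have [| | _ h5 _] := leaf_over mq; lra.
Qed.

Lemma vcut_under_newr k : under X k r = false.
Proof.
apply/negbTE/negP => h; have /negP[] := introT (leafPn tX _) (ex_intro _ k h).
by rewrite vcut_leaf_new.
Qed.

Lemma vcut_abut k m : abut X (lift r k) (lift r m) = (k != q) && abut X' k m.
Proof.
have [h1 h2 h3] := vcut_bounds.
rewrite /abut (vcut_xmin c) !(vcut_ymin c) !(vcut_ymax c).
have [-> | kq] /= := eqVneq k q; last by rewrite (vcut_xmax c).
apply/negbTE/negP => /and3P[/eqP E _ _].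
have mq : m != q by apply/eqP => mq; rewrite mq in E; lra.
have wm := xmin_lt_xmax (X' m).
by have [| | _ h5 _] := leaf_over mq; lra.
Qed.

Lemma vcut_abut_newl m : abut X r (lift r m) = abut X' q m.
Proof.
rewrite /abut (vcut_xmin c) (vcut_ymin c) (vcut_ymax c) (vcut_xmax_new c).
by rewrite (vcut_ymin_new c) (vcut_ymax_new c) (vcut_leaf c).
Qed.

Lemma vcut_abut_newr k : abut X (lift r k) r = (k == q).
Proof.
have [h1 h2 h3] := vcut_bounds.
rewrite /abut (vcut_ymin c) (vcut_ymax c) (vcut_xmin_new c).
rewrite (vcut_ymin_new c) (vcut_ymax_new c).
have [-> | kq] := eqVneq k q; first by rewrite eqxx (vcut_leaf c) h3.
rewrite (vcut_xmax c) //; apply/negbTE/negP => /and3P[/eqP E _ _].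
have wk := xmin_lt_xmax (X' k).
by have [| | _ _ h5] := leaf_over kq; lra.
Qed.

Lemma vcut_focus : focus O X' q -> focus O X r.
Proof.
have [h1 h2 h3] := vcut_bounds; have wr := xmin_lt_xmax (X r).
move=> fq; split; first exact: vcut_leaf_new.
  move=> k m lk lm /eqP; rewrite -(leaf_adjacent lk lm) (vcut_xmax_new c).
  move: lk lm; case: (unliftP r m) => [m' -> | ->].
    case: (unliftP r k) => [k' -> | ->]; rewrite !vcut_leaf_old.
      move=> lk lm; rewrite vcut_abut (leaf_adjacent lk lm) !(vcut_ymax c).
      move=> /andP[kq /eqP E] h; apply: (focus_before fq lk lm E).
      by have [-> // | mq] := eqVneq m' q; rewrite -(vcut_xmax c mq).
    move=> _ lm /and3P[/eqP E _ _] h; rewrite (vcut_xmin c) (vcut_xmax_new c) in E.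
    by have := xmin_lt_xmax (X (lift r m')); rewrite (vcut_xmin c); lra.
  case: (unliftP r k) => [k' -> | ->] // _ _.
    by rewrite vcut_abut_newr => /eqP -> _; rewrite (vcut_ymax c) (vcut_ymax_new c).
move=> m; case: (unliftP r m) => [m' -> | -> _]; last by lra.
rewrite vcut_leaf_old (vcut_xmax_new c) (vcut_xmin c) (vcut_ymax_new c).
by rewrite (vcut_ymax c); exact: (focus_next fq).
Qed.

Lemma vcut_rank : rank O X r = (rank O X' q).+1.
Proof.
rewrite (@rank_next _ _ _ _ tX (lift r q)) ?vcut_leaf_new ?(vcut_xmin_new c) //.
  congr _.+1; rewrite /rank (bigD1_ord r) //= vcut_left_of_newl left_ofxx andbF add0n.
  by apply: eq_bigr => k _; rewrite vcut_leaf_old vcut_left_of.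
by rewrite vcut_leaf_old /leaf (vcut_leaf c).
Qed.

Lemma vcut_nleaves : nleaves O X = (nleaves O X').+1.
Proof.
rewrite /nleaves (bigD1_ord r) //= vcut_leaf_new add1n; congr _.+1.
by apply: eq_bigr => k _; rewrite vcut_leaf_old.
Qed.
End VCut.

(** * Cuts and merges preserve the coordinate conditions *)

Lemma lift_cases n (r : 'I_n.+1) (P : 'I_n.+1 -> Prop) :
  P r -> (forall k, P (lift r k)) -> forall i, P i.
Proof. by move=> Pr Pl i; case: (unliftP r i) => [k ->|->]. Qed.

(** Only the exclusion of crossings uses [hcut_low]: a floor at the height of the cut, directly
    across a wall of [q], would belong to a rectangle overlapping the neighbouring leaf. *)
Lemma bottomed_hcut (R : realType) n (O : rectangle R) (X' : 'I_n -> rectangle R)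
    (X : 'I_n.+1 -> rectangle R) q r (tX' : bottomed O X')
    (c : hcut O X' X q r) : bottomed O X.
Proof.
have h1 := ymin_lt_ymax (X (lift r q)); rewrite -(hcut_ymax_new c) (hcut_ymax c) in h1.
have h2 := ymin_lt_ymax (X r); rewrite (hcut_ymin_new c) in h2.
have h3 := hcut_leaf c; have wq := xmin_lt_xmax (X' q).
have bq := hcut_ymax_new c.
have low k : k != q -> ymin (X (lift r k)) = ymin (X' k) by apply: hcut_ymin c _.
have ymin_le k : ymin (X' k) <= ymin (X (lift r k)).
  by have [-> | kq] := eqVneq k q; [rewrite -bq; lra | rewrite low].
have apart k m : xmin (X' k) < xmax (X' m) -> xmin (X' m) < xmax (X' k) ->
    ymin (X (lift r k)) < ymax (X' m) -> ymin (X (lift r m)) < ymax (X' k) -> k = m.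
  move=> *; have := ymin_le k; have := ymin_le m => ? ?.
  by apply: (bottomed_apart tX'); lra.
have apart_new k : xmin (X' k) < xmax (X' q) -> xmin (X' q) < xmax (X' k) ->
    ymin (X (lift r k)) < ymax (X r) -> False.
  move=> a1 a2 a3; have kq : k != q by apply/eqP => E; rewrite E in a3; lra.
  have bk := bottomed_ymin tX' k; have hk := ymin_lt_ymax (X' k).
  rewrite low // in a3; move/eqP: kq; apply.
  by apply: (bottomed_apart tX'); lra.
split.
- apply: (lift_cases (r := r)) => [|k]; rewrite ?(hcut_xmin c) ?(hcut_xmin_new c);
    exact: bottomed_xmin tX' _.
- apply: (lift_cases (r := r)) => [|k]; rewrite ?(hcut_xmax c) ?(hcut_xmax_new c);
    exact: bottomed_xmax tX' _.
- apply: (lift_cases (r := r)) => [|k]; first by rewrite (hcut_ymin_new c).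
  exact: le_trans (bottomed_ymin tX' k) (ymin_le k).
- apply: (lift_cases (r := r)) => [|k].
    by have := bottomed_ymax tX' q; lra.
  by rewrite (hcut_ymax c); exact: bottomed_ymax tX' _.
- apply: (lift_cases (r := r)) => [|k]; apply: (lift_cases (r := r)) => [|m] //;
    rewrite ?(hcut_xmin c) ?(hcut_xmax c) ?(hcut_ymax c) ?(hcut_xmin_new c)
      ?(hcut_xmax_new c) ?(hcut_ymin_new c) => a1 a2 a3 a4.
  + by case: (apart_new m).
  + by case: (apart_new k).
  + by congr (lift r); apply: apart.
- move=> x y hx hy; have [k [kx ky]] := bottomed_cover tX' hx hy.
  have [E | kq] := eqVneq k q; last first.
    by exists (lift r k); rewrite (hcut_xmin c) (hcut_xmax c) (hcut_ymax c) low.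
  rewrite E in kx ky; have [h | h] := ltP y (ymax (X r)).
    by exists r; rewrite (hcut_xmin_new c) (hcut_xmax_new c) (hcut_ymin_new c); lra.
  by exists (lift r q); rewrite (hcut_xmin c) (hcut_xmax c) (hcut_ymax c) -bq; lra.
- apply: (lift_cases (r := r)) => [|k]; apply: (lift_cases (r := r)) => [|m] //;
    rewrite ?(hcut_xmin c) ?(hcut_xmax c) ?(hcut_ymax c) ?(hcut_xmin_new c)
      ?(hcut_xmax_new c) ?(hcut_ymin_new c) => a1 a2.
  + lra.
  + by have := bottomed_wall_min tX' a1 a2; have := ymin_le m; lra.
  + by have := bottomed_wall_min tX' a1 a2; lra.
  + by have := bottomed_wall_min tX' a1 a2; have := ymin_le m; lra.
- apply: (lift_cases (r := r)) => [|k]; apply: (lift_cases (r := r)) => [|m] //;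
    rewrite ?(hcut_xmin c) ?(hcut_xmax c) ?(hcut_ymax c) ?(hcut_xmin_new c)
      ?(hcut_xmax_new c) ?(hcut_ymin_new c) => a1 a2.
  + lra.
  + by have := bottomed_wall_max tX' a1 a2; have := ymin_le m; lra.
  + by have := bottomed_wall_max tX' a1 a2; lra.
  + by have := bottomed_wall_max tX' a1 a2; have := ymin_le m; lra.
- apply: (lift_cases (r := r)) => [|k]; apply: (lift_cases (r := r)) => [|m] //;
    rewrite ?(hcut_xmin c) ?(hcut_xmax c) ?(hcut_ymax c) ?(hcut_xmin_new c)
      ?(hcut_xmax_new c) ?(hcut_ymin_new c) // => a1 a2.
  have [wk wm] := (xmin_lt_xmax (X' k), xmin_lt_xmax (X' m)).
  have [E | kq] := eqVneq k q; have [E' | mq] := eqVneq m q.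
  + by rewrite E E' in a1; lra.
  + rewrite E (low m mq) -bq in a2; rewrite E in a1.
    have [|z lz zE] := @leaf_right _ _ _ _ tX' q.
      by have := bottomed_xmax tX' m; lra.
    have hz := hcut_low c lz (or_intror zE); have wz := xmin_lt_xmax (X' z).
    have hm := ymin_lt_ymax (X' m); move/eqP: lz => lz.
    have E2 : m = z by apply: (bottomed_apart tX'); lra.
    by rewrite E2 in a2; lra.
  + rewrite E' (low k kq) -bq in a2; rewrite E' in a1.
    have [|z lz zE] := @leaf_left _ _ _ _ tX' q.
      by have := bottomed_xmin tX' k; lra.
    have hz := hcut_low c lz (or_introl zE); have wz := xmin_lt_xmax (X' z).
    have hk := ymin_lt_ymax (X' k); move/eqP: lz => lz.
    have E2 : k = z by apply: (bottomed_apart tX'); lra.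
    by rewrite E2 in a2; lra.
  + by rewrite (low k kq) (low m mq) in a2 *; exact: (bottomed_nocross tX') a1 a2.
Qed.

Lemma hcut_bottomed (R : realType) n (O : rectangle R) (X' : 'I_n -> rectangle R)
    (X : 'I_n.+1 -> rectangle R) q r (tX : bottomed O X)
    (c : hcut O X' X q r) : bottomed O X'.
Proof.
have h1 := ymin_lt_ymax (X (lift r q)); rewrite -(hcut_ymax_new c) (hcut_ymax c) in h1.
have h2 := ymin_lt_ymax (X r); rewrite (hcut_ymin_new c) in h2.
have h3 := hcut_leaf c; have wq := xmin_lt_xmax (X' q).
have xnew := hcut_xmin_new c; have Xnew := hcut_xmax_new c; have ynew := hcut_ymin_new c.
have bq := hcut_ymax_new c.
have low k : k != q -> ymin (X' k) = ymin (X (lift r k)).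
  by move=> kq; rewrite (hcut_ymin c kq).
have rl k : r <> lift r k by apply/eqP/neq_lift.
(* Whatever overlaps the merged leaf overlaps its lower part [r] or its upper part, according to
   where its top lies. *)
have aq k : k != q -> xmin (X' k) < xmax (X' q) -> xmin (X' q) < xmax (X' k) ->
    ymin (X' k) < ymax (X' q) -> ymin (X' q) < ymax (X' k) -> False.
  move=> kq a1 a2 a3 a4; rewrite low // in a3.
  have [h | h] := leP (ymax (X' k)) (ymax (X r)).
    apply: (rl k); apply: (bottomed_apart tX);
      rewrite ?(hcut_xmin c) ?(hcut_xmax c) ?(hcut_ymax c) ?xnew ?Xnew ?ynew; try lra.
    by have := ymin_lt_ymax (X (lift r k)); rewrite (hcut_ymax c); lra.
  move/eqP: kq; apply; apply: (@lift_inj _ r); apply: (bottomed_apart tX);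
    rewrite ?(hcut_xmin c) ?(hcut_xmax c) ?(hcut_ymax c) -?bq; lra.
split.
- by move=> i; rewrite -(hcut_xmin c); exact: (bottomed_xmin tX).
- by move=> i; rewrite -(hcut_xmax c); exact: (bottomed_xmax tX).
- move=> i; have [-> | iq] := eqVneq i q; first by rewrite h3.
  by rewrite low //; exact: (bottomed_ymin tX).
- by move=> i; rewrite -(hcut_ymax c); exact: (bottomed_ymax tX).
- move=> i j a1 a2 a3 a4.
  have [E | iq] := eqVneq i q; have [E' | jq] := eqVneq j q.
  + by rewrite E E'.
  + by rewrite E in a1 a2 a3 a4; case: (aq j).
  + by rewrite E' in a1 a2 a3 a4; case: (aq i).
  + apply: (@lift_inj _ r); apply: (bottomed_apart tX);
      by rewrite ?(hcut_xmin c) ?(hcut_xmax c) ?(hcut_ymax c) -?low.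
- move=> x y hx hy; have [i [ix iy]] := bottomed_cover tX hx hy.
  move: ix iy; case: (unliftP r i) => [k -> | ->].
    rewrite (hcut_xmin c) (hcut_xmax c) (hcut_ymax c) => kx.
    have [E | kq] := eqVneq k q; last by rewrite -low //; exists k.
    by rewrite E -bq => ky; exists q; rewrite -E; split=> //; rewrite E; lra.
  by rewrite xnew Xnew ynew => ix iy; exists q; split=> //; lra.
- move=> i j a1 a2; rewrite -(hcut_ymax c).
  have [E | jq] := eqVneq j q.
    by rewrite E h3 -ynew; apply: (bottomed_wall_min tX);
      rewrite (hcut_xmin c) ?xnew ?Xnew -E.
  by rewrite low //; apply: (bottomed_wall_min tX); rewrite !(hcut_xmin c) ?(hcut_xmax c).
- move=> i j a1 a2; rewrite -(hcut_ymax c).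
  have [E | jq] := eqVneq j q.
    by rewrite E h3 -ynew; apply: (bottomed_wall_max tX);
      rewrite (hcut_xmax c) ?xnew ?Xnew -E.
  by rewrite low //; apply: (bottomed_wall_max tX); rewrite !(hcut_xmax c) ?(hcut_xmin c).
- move=> i j a1 a2.
  have [E | iq] := eqVneq i q; first by rewrite E.
  have [E | jq] := eqVneq j q; first by rewrite a2 E.
  rewrite (low i iq) (low j jq) in a2 *; apply: (bottomed_nocross tX) a2.
  by rewrite (hcut_xmin c) (hcut_xmax c).
Qed.

(** What is new is the wall at [x]: a rectangle that straddles its line lies over [q], hence above
    the wall. *)
Lemma bottomed_vcut (R : realType) n (O : rectangle R) (X' : 'I_n -> rectangle R)
    (X : 'I_n.+1 -> rectangle R) q r (tX' : bottomed O X')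
    (c : vcut O X' X q r) : bottomed O X.
Proof.
have [h1 h2 h3] := vcut_bounds c; have h4 := vcut_leaf c.
set x := xmax (X (lift r q)) in h1 h2.
have over m : m != q -> xmin (X' m) < xmax (X' q) -> xmin (X' q) < xmax (X' m) ->
    [/\ ymax (X' q) <= ymin (X' m), xmin (X' m) <= xmin (X' q)
      & xmax (X' q) <= xmax (X' m)] by exact: (leaf_over tX' c).
have xm k : k != q -> xmax (X (lift r k)) = xmax (X' k) by apply: vcut_xmax c _.
have xq : xmax (X (lift r q)) = x by [].
have xmax_le k : xmax (X (lift r k)) <= xmax (X' k).
  by have [-> | kq] := eqVneq k q; [rewrite xq; lra | rewrite xm].
have xnew : xmin (X r) = x by rewrite (vcut_xmin_new c).
have fields := (xnew, vcut_xmin c, vcut_ymin c, vcut_ymax c, vcut_xmax_new c,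
  vcut_ymin_new c, vcut_ymax_new c).
have apart_new k : xmin (X' k) < xmax (X' q) -> x < xmax (X (lift r k)) ->
    ymin (X' k) < ymax (X' q) -> False.
  move=> a1 a2 a3; have kq : k != q by apply/eqP => E; rewrite E xq in a2; lra.
  rewrite xm // in a2; have wk := xmin_lt_xmax (X' k).
  by have [| | ] := over k kq; lra.
split.
- apply: (lift_cases (r := r)) => [|k]; rewrite !fields; last exact: bottomed_xmin tX' _.
  by have := bottomed_xmin tX' q; lra.
- apply: (lift_cases (r := r)) => [|k]; rewrite ?fields; first exact: bottomed_xmax tX' _.
  exact: le_trans (xmax_le k) (bottomed_xmax tX' k).
- apply: (lift_cases (r := r)) => [|k]; rewrite !fields //; exact: bottomed_ymin tX' _.
- apply: (lift_cases (r := r)) => [|k]; rewrite !fields; exact: bottomed_ymax tX' _.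
- apply: (lift_cases (r := r)) => [|k]; apply: (lift_cases (r := r)) => [|m] //;
    rewrite ?fields => a1 a2 a3 a4.
  + by case: (apart_new m).
  + by case: (apart_new k).
  + congr (lift r); have := xmax_le k; have := xmax_le m => ? ?.
    by apply: (bottomed_apart tX'); lra.
- move=> u v hu hv; have [k [ku kv]] := bottomed_cover tX' hu hv.
  have [E | kq] := eqVneq k q; last first.
    by exists (lift r k); rewrite !fields xm.
  rewrite E in ku kv; have [h | h] := ltP u x.
    by exists (lift r q); rewrite !fields xq; lra.
  by exists r; rewrite !fields; lra.
- apply: (lift_cases (r := r)) => [|k]; apply: (lift_cases (r := r)) => [|m] //;
    rewrite ?fields => a1 a2.
  + lra.
  + have mq : m != q by apply/eqP => E; rewrite E xq in a2; lra.
    by rewrite xm // in a2; have [| | ] := over m mq; lra.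
  + have kq : k != q by apply/eqP => E; rewrite E in a1; lra.
    have wk := xmin_lt_xmax (X' k).
    have := @bottomed_wall_min _ _ _ _ tX' k q; lra.
  + by apply: (bottomed_wall_min tX' a1); have := xmax_le m; lra.
- apply: (lift_cases (r := r)) => [|k]; apply: (lift_cases (r := r)) => [|m] //;
    rewrite ?fields => a1 a2.
  + lra.
  + by apply: (bottomed_wall_max tX' a1); have := xmax_le m; lra.
  + have kq : k != q by apply/eqP => E; rewrite E xq in a1; lra.
    rewrite xm // in a1 a2; have wk := xmin_lt_xmax (X' k).
    have := @bottomed_wall_max _ _ _ _ tX' k q; lra.
  + have [E | kq] := eqVneq k q.
      rewrite E xq in a1 a2 *; have mq : m != q by apply/eqP => E'; rewrite E' xq in a2; lra.
      by rewrite xm // in a2; have [| | ] := over m mq; lra.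
    rewrite xm // in a1 a2; apply: (bottomed_wall_max tX' a1).
    by have := xmax_le m; lra.
- apply: (lift_cases (r := r)) => [|k]; apply: (lift_cases (r := r)) => [|m] //;
    rewrite ?fields // => a1 a2.
  have [E | kq] := eqVneq k q; last first.
    by apply: (bottomed_nocross tX') a2; rewrite -xm.
  by rewrite E.
Qed.

(* The wall between two leaves of equal height ends at the segment above both,
   so no other rectangle has a side on its line. *)
Lemma level_leaves_wall (R : realType) n (O : rectangle R)
    (X : 'I_n -> rectangle R) (tX : bottomed O X) k m :
  leaf O X k -> leaf O X m -> xmax (X k) = xmin (X m) ->
  ymax (X k) = ymax (X m) ->
  (forall i, xmin (X i) = xmin (X m) -> i = m) /\
  (forall i, xmax (X i) = xmax (X k) -> i = k).
Proof.
move=> /eqP lk /eqP lm E Et.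
bounds X k => hk wk; bounds X m => hm wm.
(* The rectangles resting on [k] and on [m] have equal floors. If they were different, they would
   meet on the wall, and their floors would cross it. *)
have above_parent : ymax (X k) < ymax O -> exists p,
    [/\ ymin (X p) = ymax (X k), xmin (X p) <= xmin (X k) & xmax (X m) <= xmax (X p)].
  move=> hO; have [p [p1 p2 p3]] := bottomed_parent tX hO.
  have [|p' [p1' p2' p3']] := @bottomed_parent _ _ _ _ tX m; first lra.
  bounds X p => hp wp; bounds X p' => hp' wp'; exists p; split => //.
  have [E' | pp'] := eqVneq p p'; first by rewrite E'.
  have apart := @bottomed_apart _ _ _ _ tX p p'.
  have nc := @bottomed_nocross _ _ _ _ tX p p'.
  have [h | h] := ltP (xmin (X p')) (xmax (X p)).
    by case/eqP: pp'; apply: apart; lra.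
  by have := nc; rewrite p1 p1' => /(_ ltac:(lra) ltac:(lra)); lra.
split=> i Ei; bounds X i => hi wi; apply/eqP; apply: contraT => ne.
  have bi : ymax (X m) <= ymin (X i).
    rewrite leNgt; apply/negP => h; case/eqP: ne.
    by apply: (bottomed_apart tX); have := bottomed_ymin tX i; lra.
  have [|p [p1 p2 p3]] := above_parent; first by have := bottomed_ymax tX i; lra.
  by have := @bottomed_wall_min _ _ _ _ tX i p; lra.
have bi : ymax (X k) <= ymin (X i).
  rewrite leNgt; apply/negP => h; case/eqP: ne.
  by apply: (bottomed_apart tX); have := bottomed_ymin tX i; lra.
have [|p [p1 p2 p3]] := above_parent; first by have := bottomed_ymax tX i; lra.
by have := @bottomed_wall_max _ _ _ _ tX i p; lra.
Qed.

(** After the merge the line at [x] no longer reaches the bottom, so another rectangle with a side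
    on it would violate the wall conditions of [X']; [level_leaves_wall] shows that there is
    none. *)
Lemma vcut_bottomed (R : realType) n (O : rectangle R) (X' : 'I_n -> rectangle R)
    (X : 'I_n.+1 -> rectangle R) q r (tX : bottomed O X)
    (c : vcut O X' X q r) : bottomed O X'.
Proof.
have [h1 h2 h3] := vcut_bounds c; have h4 := vcut_leaf c.
set x := xmax (X (lift r q)) in h1 h2.
have xm k : k != q -> xmax (X' k) = xmax (X (lift r k)).
  by move=> kq; rewrite (vcut_xmax c kq).
have xq : xmax (X (lift r q)) = x by [].
have xnew : xmin (X r) = x by rewrite (vcut_xmin_new c).
have fields := (xnew, vcut_xmin c, vcut_ymin c, vcut_ymax c, vcut_xmax_new c,
  vcut_ymin_new c, vcut_ymax_new c).
have rl k : r <> lift r k by apply/eqP/neq_lift.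
have [] := @level_leaves_wall _ _ _ _ tX (lift r q) r; rewrite /leaf ?fields ?h4 //.
move=> no_min no_max.
have aq k : k != q -> xmin (X' k) < xmax (X' q) -> xmin (X' q) < xmax (X' k) ->
    ymin (X' k) < ymax (X' q) -> ymin (X' q) < ymax (X' k) -> False.
  move=> kq a1 a2 a3 a4; have xk := xm k kq.
  have [h | h] := ltP (xmin (X' k)) x.
    move/eqP: kq; apply; apply: (@lift_inj _ r); apply: (bottomed_apart tX);
      by rewrite ?fields ?xq -?xk.
  have wk := xmin_lt_xmax (X' k).
  by apply: (rl k); apply: (bottomed_apart tX); rewrite ?fields -?xk //; lra.
split.
- by move=> i; rewrite -(vcut_xmin c); exact: (bottomed_xmin tX).
- move=> i; have [-> | iq] := eqVneq i q.
    by rewrite -(vcut_xmax_new c); exact: (bottomed_xmax tX).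
  by rewrite xm //; exact: (bottomed_xmax tX).
- by move=> i; rewrite -(vcut_ymin c); exact: (bottomed_ymin tX).
- by move=> i; rewrite -(vcut_ymax c); exact: (bottomed_ymax tX).
- move=> i j a1 a2 a3 a4.
  have [E | iq] := eqVneq i q; have [E' | jq] := eqVneq j q.
  + by rewrite E E'.
  + by rewrite E in a1 a2 a3 a4; case: (aq j).
  + by rewrite E' in a1 a2 a3 a4; case: (aq i).
  + by apply: (@lift_inj _ r); apply: (bottomed_apart tX); rewrite ?fields -?xm.
- move=> u v hu hv; have [i [iu iv]] := bottomed_cover tX hu hv.
  move: iu iv; case: (unliftP r i) => [k -> | ->]; rewrite !fields; last first.
    by move=> ? ?; exists q; lra.
  have [E | kq] := eqVneq k q; last by rewrite -xm //; exists k.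
  by rewrite E xq => ? ?; exists q; lra.
- move=> i j a1 a2; rewrite -(vcut_ymax c).
  have [E | jq] := eqVneq j q; last first.
    rewrite -(vcut_ymin c); apply: (bottomed_wall_min tX);
    by rewrite ?(vcut_xmin c) -?xm.
  rewrite E h4; rewrite E in a1 a2; have [h | h | h] := ltrgtP (xmin (X' i)) x.
  + rewrite -h4 -(vcut_ymin c); apply: (bottomed_wall_min tX);
    by rewrite ?(vcut_xmin c) ?xq.
  + rewrite -(vcut_ymin_new c); apply: (bottomed_wall_min tX);
    by rewrite ?fields.
  + by case: (rl i); rewrite (no_min (lift r i)) // (vcut_xmin c).
- move=> i j a1 a2; rewrite -(vcut_ymax c).
  have [E | jq] := eqVneq j q; last first.
    have [Ei | iq] := eqVneq i q.
      rewrite Ei (vcut_ymax c) -(vcut_ymax_new c) -(vcut_ymin c).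
      by rewrite Ei in a1 a2; apply: (bottomed_wall_max tX); rewrite ?fields -?xm.
    rewrite -(vcut_ymin c); apply: (bottomed_wall_max tX);
    by rewrite ?(vcut_xmin c) -?xm.
  rewrite E h4; rewrite E in a1 a2.
  have iq : i != q by apply/eqP => Ei; rewrite Ei in a2; lra.
  rewrite (xm i iq) in a1 a2; have [h | h | h] := ltrgtP (xmax (X (lift r i))) x.
  + rewrite -h4 -(vcut_ymin c); apply: (bottomed_wall_max tX);
    by rewrite ?(vcut_xmin c) ?xq.
  + rewrite -(vcut_ymin_new c); apply: (bottomed_wall_max tX);
    by rewrite ?fields.
  + by case/eqP: iq; apply: (@lift_inj _ r); apply: no_max.
- move=> i j a1 a2; rewrite -(vcut_ymin c); have [E | iq] := eqVneq i q.
    by rewrite E (vcut_ymin c).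
  apply: (bottomed_nocross tX (j := lift r j)); last by rewrite !(vcut_ymin c).
  by rewrite (vcut_xmin c) -xm.
Qed.

Lemma hcut_exists (R : realType) n (O : rectangle R) (X' : 'I_n -> rectangle R)
    (tX' : bottomed O X') q : leaf O X' q ->
  exists X : 'I_n.+1 -> rectangle R, hcut O X' X q ord0.
Proof.
move=> /eqP lq.
(* Cutting halfway below the lowest top of all rectangles is low enough for [q] and for its
   neighbours. *)
case: (@arg_minP _ _ _ q xpredT (fun k => ymax (X' k)) isT) => z _ zmin.
have zle k : ymax (X' z) <= ymax (X' k) by exact: zmin.
pose y := (ymin O + ymax (X' z)) / 2%:R.
have hz : ymin O < ymax (X' z).
  exact: le_lt_trans (bottomed_ymin tX' z) (ymin_lt_ymax _).
have y1 : ymin O < y by rewrite /y; lra.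
have y2 k : y < ymax (X' k) by have := zle k; rewrite /y; lra.
pose Y := Rectangle (xmin_lt_xmax (X' q)) (y2 q).
pose Z := Rectangle (xmin_lt_xmax (X' q)) y1.
exists (fun i => if unlift ord0 i is Some k then if k == q then Y else X' k else Z).
split=> //; try by move=> k; rewrite liftK; case: eqVneq => // ->.
- by rewrite unlift_none.
- by rewrite unlift_none.
- by rewrite unlift_none.
- by rewrite unlift_none liftK eqxx.
- by move=> m _ _; rewrite unlift_none.
Qed.

Lemma vcut_exists (R : realType) n (O : rectangle R) (X' : 'I_n -> rectangle R)
    q : leaf O X' q ->
  exists X : 'I_n.+1 -> rectangle R, vcut O X' X q ord0.
Proof.
move=> /eqP lq; have wq := xmin_lt_xmax (X' q).
pose x := (xmin (X' q) + xmax (X' q)) / 2%:R.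
have x1 : xmin (X' q) < x by rewrite /x; lra.
have x2 : x < xmax (X' q) by rewrite /x; lra.
pose Y := Rectangle x1 (ymin_lt_ymax (X' q)).
pose Z := Rectangle x2 (ymin_lt_ymax (X' q)).
exists (fun i => if unlift ord0 i is Some k then if k == q then Y else X' k else Z).
split=> //; try by move=> k; rewrite liftK; case: eqVneq => // ->.
- by rewrite unlift_none liftK eqxx.
- by rewrite unlift_none.
- by rewrite unlift_none.
- by rewrite unlift_none.
Qed.

(* If the leaf left of the focus is strictly higher, the horizontal segment
   above the focus spans exactly the focus. *)
Lemma focus_under_parent (R : realType) n (O : rectangle R)
    (X : 'I_n.+2 -> rectangle R) (tX : bottomed O X) u (fu : focus O X u) :
  (forall k, leaf O X k -> xmax (X k) = xmin (X u) -> ymax (X u) < ymax (X k)) ->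
  exists p, [/\ ymin (X p) = ymax (X u), xmin (X p) = xmin (X u)
    & xmax (X p) = xmax (X u)].
Proof.
move=> hlow; have /eqP lu := focus_leaf fu; bounds X u => hu wu.
have [ul ur] := (bottomed_xmin tX u, bottomed_xmax tX u).
have left_low : xmin O < xmin (X u) ->
    exists2 k, xmax (X k) = xmin (X u) & ymax (X u) < ymax (X k).
  by move=> /(leaf_left tX)[k lk E]; exists k => //; exact: hlow.
have right_low : xmax (X u) < xmax O ->
    exists2 k, xmin (X k) = xmax (X u) & ymax (X u) < ymax (X k).
  by move=> /(leaf_right tX)[k lk E]; exists k => //; exact: (focus_next fu).
(* A focus reaching the top could have no higher neighbour, so it would fill [O]; but there are at
   least two rectangles. *)
have tu : ymax (X u) < ymax O.
  rewrite ltNge; apply/negP => tu; have not_above k : ~ ymax (X u) < ymax (X k).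
    by have := bottomed_ymax tX k; lra.
  have E1 : xmin (X u) <= xmin O.
    by rewrite leNgt; apply/negP => /left_low[k _ /not_above].
  have E2 : xmax O <= xmax (X u).
    by rewrite leNgt; apply/negP => /right_low[k _ /not_above].
  pose k := lift u ord0; bounds X k => hk wk.
  suff E : u = k by have := neq_lift u ord0; rewrite -/k E eqxx.
  have := bottomed_xmin tX k; have := bottomed_xmax tX k.
  have := bottomed_ymin tX k; have := bottomed_ymax tX k => ? ? ? ?.
  by apply: (bottomed_apart tX); lra.
have [p [p1 p2 p3]] := bottomed_parent tX tu; have hp := ymin_lt_ymax (X p).
exists p; split=> //; apply/eqP; rewrite eq_le ?p2 ?p3 /= ?andbT leNgt;
  apply/negP => h.
  have [|k k1 k2] := left_low; first by have := bottomed_xmin tX p; lra.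
  by have := @bottomed_wall_max _ _ _ _ tX k p; lra.
have [|k k1 k2] := right_low; first by have := bottomed_xmax tX p; lra.
by have := @bottomed_wall_min _ _ _ _ tX k p; lra.
Qed.

(** The leaf left of the focus is never lower. If it has equal height, the wall between the two is
    removed. If it is higher or absent, the rectangle resting on the focus has the same width, and
    the two are merged. *)
Lemma uncut (R : realType) n (O : rectangle R) (X : 'I_n.+2 -> rectangle R)
    (tX : bottomed O X) : exists (X' : 'I_n.+1 -> rectangle R) q r,
  hcut O X' X q r /\ no_rise_before O X' q \/ vcut O X' X q r /\ focus O X' q.
Proof.
have [u fu] := focus_exists tX; have /eqP lu := focus_leaf fu.
bounds X u => hu wu.
have [[k [lk E Et]] | nlevel] :=
    pselect (exists k, [/\ leaf O X k, xmax (X k) = xmin (X u) & ymax (X k) = ymax (X u)]).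
  have [q qE] : exists q, k = lift u q.
    by case: (unliftP u k) E => [q -> | ->]; [exists q | lra].
  rewrite {k}qE in lk E Et; bounds X (lift u q) => hq wq.
  have wY : xmin (X (lift u q)) < xmax (X u) by lra.
  pose Y := Rectangle wY (ymin_lt_ymax (X (lift u q))).
  pose X' i := if i == q then Y else X (lift u i).
  have X'q : X' q = Y by rewrite /X' eqxx.
  have X'E i : i != q -> X' i = X (lift u i) by move=> iq; rewrite /X' (negbTE iq).
  have c : vcut O X' X q u.
    split=> //; rewrite ?X'q //=; try by move=> i; rewrite /X'; case: eqVneq => // ->.
    - exact/eqP.
  exists X', q, u; right; split=> //.
  have leafE i : leaf O X' i = leaf O X (lift u i) by rewrite (vcut_leaf_old c).
  split; first by rewrite leafE.
    move=> i j; rewrite !leafE => li lj.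
    have wj := xmin_lt_xmax (X' j).
    rewrite -!(vcut_xmin c) -!(vcut_ymax c) -(vcut_xmax_new c).
    rewrite -(vcut_xmin c) in wj.
    have [-> | iq] := eqVneq i q; first by rewrite X'q /=; lra.
    rewrite X'E // => Eij h; apply: (focus_before fu li lj Eij).
    by move: h; have [-> | jq] := eqVneq j q; [rewrite X'q /=; lra | rewrite X'E].
  move=> j; rewrite leafE X'q /= => lj; rewrite -(vcut_xmin c) -(vcut_ymax c) Et.
  exact: (focus_next fu).
have hlow k : leaf O X k -> xmax (X k) = xmin (X u) -> ymax (X u) < ymax (X k).
  move=> lk E; rewrite lt_neqAle (focus_before fu lk (focus_leaf fu)) // andbT.
  by apply/eqP => Et; apply: nlevel; exists k.
have [p [p1 p2 p3]] := focus_under_parent tX fu hlow.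
have hp := ymin_lt_ymax (X p).
have [q qE] : exists q, p = lift u q.
  by case: (unliftP u p) p1 => [q -> | ->]; [exists q | lra].
rewrite {p}qE in p1 p2 p3 hp.
have hY : ymin O < ymax (X (lift u q)) by lra.
pose Y := Rectangle (xmin_lt_xmax (X (lift u q))) hY.
pose X' i := if i == q then Y else X (lift u i).
have X'q : X' q = Y by rewrite /X' eqxx.
have X'E i : i != q -> X' i = X (lift u i) by move=> iq; rewrite /X' (negbTE iq).
have c : hcut O X' X q u.
  split=> //; rewrite ?X'q //=; try by move=> i; rewrite /X'; case: eqVneq => // ->.
  - move=> m lm; bounds X' m => hm wm adj.
    have mq : m != q.
      by apply/eqP => mE; rewrite mE X'q /= in wm adj; case: adj; lra.
    rewrite /leaf X'E // in lm; rewrite X'E // p2 p3 in adj *.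
    by case: adj => adj; [exact: hlow | exact: (focus_next fu)].
exists X', q, u; left; split=> // i j; rewrite X'q /= => li lj Eij h.
have [wi wj] := (xmin_lt_xmax (X' i), xmin_lt_xmax (X' j)).
have wq := xmin_lt_xmax (X (lift u q)).
have jq : j != q by apply/eqP => E; rewrite E X'q /= in wj h; lra.
have iq : i != q by apply/eqP => E; rewrite E X'q /= in wi Eij; lra.
rewrite /leaf !X'E // in li lj Eij wj h *.
by apply: (focus_before fu li lj Eij); lra.
Qed.

(** * Words of rectangulations *)

(** A relation rather than a function: it fixes neither the labels nor the coordinates of [X'], so
    the same definition serves for taking a rectangulation apart and for building one. Uniqueness of
    the word is [coded_uniq]. *)
Fixpoint coded (R : realType) (O : rectangle R) (n : nat) :
    ('I_n.+1 -> rectangle R) -> seq (option nat) -> Prop :=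
  match n with
  | 0%N => fun _ w => w = [::]
  | n'.+1 => fun X w =>
      exists (X' : 'I_n'.+1 -> rectangle R) q r w',
        [/\ bottomed O X', coded O X' w' &
          [/\ hcut O X' X q r, no_rise_before O X' q
            & w = Some (rank O X' q) :: w'] \/
          [/\ vcut O X' X q r, focus O X' q & w = None :: w']]
  end.

Lemma coded_exists (R : realType) (O : rectangle R) n
    (X : 'I_n.+1 -> rectangle R) : bottomed O X -> exists w, coded O X w.
Proof.
elim: n X => [|n IH] X tX; first by exists [::].
have [X' [q [r h]]] := uncut tX.
have tX' : bottomed O X'.
  by case: h => [] [c _]; [exact: hcut_bottomed tX c | exact: vcut_bottomed tX c].
have [w cw] := IH _ tX'.
case: h => [] [c h]; [exists (Some (rank O X' q) :: w) | exists (None :: w)];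
  exists X', q, r, w; split=> //; by [left | right].
Qed.

Lemma coded_valid (R : realType) (O : rectangle R) n
    (X : 'I_n.+1 -> rectangle R) w : bottomed O X -> coded O X w ->
  [/\ size w = n, valid w &
    exists2 u, focus O X u & state w = (rank O X u, nleaves O X)].
Proof.
elim: n X w => [|n IH] X w tX /=.
  move=> ->; split=> //; have [u fu] := focus_exists tX; exists u => //.
  rewrite /rank /nleaves !big_ord_recl !big_ord0 (ord1 u) left_ofxx andbF.
  by have := focus_leaf fu; rewrite (ord1 u) => ->.
move=> [X' [q [r [w' [tX' cw' h]]]]].
have [sz vw' [u fu st]] := IH _ _ tX' cw'.
case: h => [] [c h ->] /=; rewrite sz st /=; split=> //.
- have lq : leaf O X' q by apply/eqP; exact: hcut_leaf c.
  by rewrite vw' (rank_lt_nleaves lq) andbT; apply/no_rise_beforeP.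
- exists r; first exact: (hcut_focus tX' c h).
  by rewrite (hcut_rank c) (hcut_nleaves c).
- exists r; first exact: (vcut_focus tX' c h).
  by rewrite (vcut_rank tX' tX c) (vcut_nleaves c) (focus_uniq tX' fu h).
Qed.

Lemma coded_realize (R : realType) (O : rectangle R) n w :
  size w = n -> valid w ->
  exists2 X : 'I_n.+1 -> rectangle R, bottomed O X & coded O X w.
Proof.
elim: n w => [|n IH] [|a w] //=.
  move=> _ _; exists (fun=> O) => //; split=> //.
  - by move=> i j; rewrite (ord1 i) (ord1 j).
  - by move=> x y hx hy; exists ord0.
  - by move=> i j; lra.
  - by move=> i j; lra.
move=> [sz] va.
have vw : valid w by case: a va => [i /and3P[]|].
have [X' tX' cw] := IH _ sz vw; have [_ _ [u fu st]] := coded_valid tX' cw.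
case: a va => [i | _].
  rewrite st /= => /and3P[_ iu il]; have [q lq qi] := rank_onto tX' il.
  have [X c] := hcut_exists tX' lq; exists X; first exact: bottomed_hcut tX' c.
  exists X', q, ord0, w; split=> //; left; split=> //; last by rewrite qi.
  by apply/(no_rise_beforeP tX' fu lq); rewrite qi.
have [X c] := vcut_exists (focus_leaf fu); exists X; first exact: bottomed_vcut tX' c.
by exists X', u, ord0, w; split=> //; right.
Qed.

(** * Words and shapes determine each other *)

Lemma underxx (R : realType) n (X : 'I_n -> rectangle R) i : under X i i = false.
Proof. by apply/negbTE/negP => /and3P[h _ _]; have := ymin_lt_ymax (X i); lra. Qed.

Lemma abutxx (R : realType) n (X : 'I_n -> rectangle R) i : abut X i i = false.
Proof.
by apply/negbTE/negP => /and3P[/eqP h _ _]; have := xmin_lt_xmax (X i); lra.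
Qed.

(** The map is extended by sending new leaf to new leaf; this is compatible because the relations of
    the new leaf are formulas in those of the leaf that was cut. *)
Lemma same_shape_hcut (R : realType) n (O1 O2 : rectangle R)
    (X1' X2' : 'I_n -> rectangle R) (X1 X2 : 'I_n.+1 -> rectangle R) q1 r1 q2 r2 f
    (t1' : bottomed O1 X1') (t1 : bottomed O1 X1) (c1 : hcut O1 X1' X1 q1 r1)
    (t2' : bottomed O2 X2') (t2 : bottomed O2 X2) (c2 : hcut O2 X2' X2 q2 r2) :
  same_shape X1' X2' f -> f q1 = q2 ->
  same_shape X1 X2 (fun i => if unlift r1 i is Some k then lift r2 (f k) else r2).
Proof.
move=> s fq.
split; apply: (lift_cases (r := r1)) => [|k]; apply: (lift_cases (r := r1)) => [|m];
  rewrite ?liftK ?unlift_none //.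
- by move=> E; have := neq_lift r2 (f m); rewrite -E eqxx.
- by move=> E; have := neq_lift r2 (f k); rewrite E eqxx.
- by move=> /lift_inj/(same_inj s) ->.
- by rewrite !left_ofxx.
- by rewrite (hcut_left_of_newl c1) (hcut_left_of_newl c2) -fq (same_left_of s).
- by rewrite (hcut_left_of_newr c1) (hcut_left_of_newr c2) -fq (same_left_of s).
- by rewrite (hcut_left_of c1) (hcut_left_of c2) (same_left_of s).
- by rewrite !underxx.
- rewrite (hcut_under_newl t1' c1) (hcut_under_newl t2' c2) -fq.
  by rewrite (inj_eq (same_inj s)) (same_under s).
- by rewrite (hcut_under_newr t1 c1) (hcut_under_newr t2 c2).
- by rewrite (hcut_under t1' t1 c1) (hcut_under t2' t2 c2) (same_under s).
- by rewrite !abutxx.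
- rewrite (hcut_abut_newl t1' c1) (hcut_abut_newl t2' c2) -fq.
  by rewrite (same_leaf t1' t2' s) (same_abut s).
- rewrite (hcut_abut_newr t1' c1) (hcut_abut_newr t2' c2) -fq.
  by rewrite (same_leaf t1' t2' s) (same_abut s).
- by rewrite (hcut_abut t1' c1) (hcut_abut t2' c2) (same_abut s).
Qed.

Lemma same_shape_vcut (R : realType) n (O1 O2 : rectangle R)
    (X1' X2' : 'I_n -> rectangle R) (X1 X2 : 'I_n.+1 -> rectangle R) q1 r1 q2 r2 f
    (t1' : bottomed O1 X1') (t1 : bottomed O1 X1) (c1 : vcut O1 X1' X1 q1 r1)
    (t2' : bottomed O2 X2') (t2 : bottomed O2 X2) (c2 : vcut O2 X2' X2 q2 r2) :
  same_shape X1' X2' f -> f q1 = q2 ->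
  same_shape X1 X2 (fun i => if unlift r1 i is Some k then lift r2 (f k) else r2).
Proof.
move=> s fq.
split; apply: (lift_cases (r := r1)) => [|k]; apply: (lift_cases (r := r1)) => [|m];
  rewrite ?liftK ?unlift_none //.
- by move=> E; have := neq_lift r2 (f m); rewrite -E eqxx.
- by move=> E; have := neq_lift r2 (f k); rewrite E eqxx.
- by move=> /lift_inj/(same_inj s) ->.
- by rewrite !left_ofxx.
- by rewrite (vcut_left_of_newl c1) (vcut_left_of_newl c2) -fq (same_left_of s).
- rewrite (vcut_left_of_newr t1' c1) (vcut_left_of_newr t2' c2) -fq.
  by rewrite (inj_eq (same_inj s)) (same_left_of s).
- by rewrite (vcut_left_of t1' c1) (vcut_left_of t2' c2) (same_left_of s).
- by rewrite !underxx.
- by rewrite (vcut_under_newl t1' c1) (vcut_under_newl t2' c2) -fq (same_under s).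
- by rewrite (vcut_under_newr t1 c1) (vcut_under_newr t2 c2).
- by rewrite (vcut_under t1' c1) (vcut_under t2' c2) (same_under s).
- by rewrite !abutxx.
- by rewrite (vcut_abut_newl c1) (vcut_abut_newl c2) -fq (same_abut s).
- rewrite (vcut_abut_newr t1' c1) (vcut_abut_newr t2' c2) -fq.
  by rewrite (inj_eq (same_inj s)).
- rewrite (vcut_abut t1' c1) (vcut_abut t2' c2) -fq.
  by rewrite (inj_eq (same_inj s)) (same_abut s).
Qed.

Lemma coded_same_shape (R : realType) n (O1 O2 : rectangle R)
    (X1 X2 : 'I_n.+1 -> rectangle R) w
    (t1 : bottomed O1 X1) (t2 : bottomed O2 X2) :
  coded O1 X1 w -> coded O2 X2 w -> exists f, same_shape X1 X2 f.
Proof.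
elim: n X1 X2 w t1 t2 => [|n IH] X1 X2 w t1 t2 /=.
  move=> _ _; exists id; split=> // i j; rewrite (ord1 i) (ord1 j).
  - by rewrite !left_ofxx.
  - by rewrite !underxx.
  - by rewrite !abutxx.
move=> [X1' [q1 [r1 [w1 [t1' cw1 h1]]]]] [X2' [q2 [r2 [w2 [t2' cw2 h2]]]]].
have E : w1 = w2.
  by case: h1 h2 => [] [_ _ ->] [] [_ _ []].
rewrite {w1}E in cw1 h1; have [f s] := IH _ _ _ t1' t2' cw1 cw2.
case: h1 h2 => [] [c1 l1 ->] [] [c2 l2 E] //.
  eexists; apply: (same_shape_hcut t1' t1 c1 t2' t2 c2 s).
  have [lq1 lq2] := (hcut_leaf c1, hcut_leaf c2).
  apply: (rank_inj t2'); first by rewrite (same_leaf t1' t2' s); apply/eqP.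
    exact/eqP.
  by case: E => E; rewrite (same_rank t1' t2' s).
eexists; apply: (same_shape_vcut t1' t1 c1 t2' t2 c2 s).
exact: (focus_uniq t2' (same_focus t1' t2' s l1) l2).
Qed.

(** After a vertical cut the leaf left of the new one has the same height, after a horizontal cut it
    is strictly higher, and the shape sees the difference. *)
Lemma same_shape_cut_kind (R : realType) n (O1 O2 : rectangle R)
    (X1' X2' : 'I_n -> rectangle R) (X1 X2 : 'I_n.+1 -> rectangle R) q1 r1 q2 r2 f
    (t1 : bottomed O1 X1) (c1 : hcut O1 X1' X1 q1 r1)
    (t2 : bottomed O2 X2) (c2 : vcut O2 X2' X2 q2 r2) :
  same_shape X1 X2 f -> f r1 = r2 -> False.
Proof.
move=> s fr; have [k kE] := same_shape_surj s (lift r2 q2).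
have lr2 := vcut_leaf_new c2; have lr1 := hcut_leaf_new c1.
have lk2 : leaf O2 X2 (f k).
  by rewrite kE (vcut_leaf_old c2) /leaf (vcut_leaf c2).
have lk1 : leaf O1 X1 k by rewrite -(same_leaf t1 t2 s).
have E : xmax (X1 k) = xmin (X1 r1).
  apply/eqP; rewrite -(same_adjacent t1 t2 s) // fr kE; apply/eqP.
  by rewrite (vcut_xmin_new c2).
have := same_fall t1 t2 s lk1 lr1 E.
rewrite fr kE (vcut_ymax_new c2) (vcut_ymax c2) ltxx => /esym/negbT/negP; apply.
move: lk1 E; case: (unliftP r1 k) => [m -> | ->]; last first.
  by have := xmin_lt_xmax (X1 r1); lra.
rewrite (hcut_leaf_old c1) (hcut_xmax c1) (hcut_xmin_new c1) (hcut_ymax c1).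
by move=> /andP[_ lm] E; apply: (hcut_low c1 lm); left.
Qed.

Lemma same_shape_sym (R : realType) n (X1 X2 : 'I_n -> rectangle R) f
  (s : same_shape X1 X2 f) : same_shape X2 X1 (invF (same_inj s)).
Proof.
split=> [|i j|i j|i j]; first exact: can_inj (f_invF _).
- by rewrite -(same_left_of s) !f_invF.
- by rewrite -(same_under s) !f_invF.
- by rewrite -(same_abut s) !f_invF.
Qed.

(** The new leaf is the unique focus, so [f] respects it. The leaf that was cut is then found again:
    after a horizontal cut as the rectangle over [r] that becomes a leaf once [r] is gone, after a
    vertical cut as the only rectangle touching [r] from the left. *)
Lemma coded_uniq (R : realType) n (O1 O2 : rectangle R)
    (X1 X2 : 'I_n.+1 -> rectangle R) w1 w2 f
    (t1 : bottomed O1 X1) (t2 : bottomed O2 X2) (s : same_shape X1 X2 f) :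
  coded O1 X1 w1 -> coded O2 X2 w2 -> w1 = w2.
Proof.
elim: n X1 X2 w1 w2 f t1 t2 s => [|n IH] X1 X2 w1 w2 f t1 t2 s /=.
  by move=> -> ->.
move=> [X1' [q1 [r1 [w1' [t1' cw1 h1]]]]] [X2' [q2 [r2 [w2' [t2' cw2 h2]]]]].
have fr : f r1 = r2.
  have f1 : focus O1 X1 r1.
    by case: h1 => [] [c h _]; [exact: (hcut_focus t1' c h) | exact: (vcut_focus t1' c h)].
  have f2 : focus O2 X2 r2.
    by case: h2 => [] [c h _]; [exact: (hcut_focus t2' c h) | exact: (vcut_focus t2' c h)].
  exact: (focus_uniq t2 (same_focus t1 t2 s f1) f2).
(* The default is never taken, since [f] sends only [r1] to [r2]. *)
pose g k := odflt k (unlift r2 (f (lift r1 k))).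
have gE k : lift r2 (g k) = f (lift r1 k).
  rewrite /g; case: (unliftP r2 (f (lift r1 k))) => [m -> // | ].
  by rewrite -fr => /(same_inj s) E; have := neq_lift r1 k; rewrite E eqxx.
have ginj : injective g.
  by move=> a b E; apply: (@lift_inj _ r1); apply: (same_inj s); rewrite -!gE E.
case: h1 h2 => [] [c1 l1 ->] [] [c2 l2 ->].
- have sg : same_shape X1' X2' g.
    split=> // i j.
    + by rewrite -(hcut_left_of c1) -(hcut_left_of c2) !gE (same_left_of s).
    + by rewrite -(hcut_under t1' t1 c1) -(hcut_under t2' t2 c2) !gE (same_under s).
    + by rewrite -(hcut_abut t1' c1) -(hcut_abut t2' c2) !gE (same_abut s).
  have gq : g q1 = q2.
    have /eqP lq1 := hcut_leaf c1.
    have := hcut_under_newl t2' c2 (g q1).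
    rewrite gE -fr (same_under s) (hcut_under_newl t1' c1) eqxx /=.
    case/esym/orP => [/eqP // | h]; have [k kE] := same_shape_surj sg q2.
    rewrite -kE (same_under sg) in h.
    by have /negP[] := introT (leafPn t1' _) (ex_intro _ k h).
  by rewrite (IH _ _ _ _ _ t1' t2' sg cw1 cw2) -gq (same_rank t1' t2' sg).
- by case: (same_shape_cut_kind t1 c1 t2 c2 s fr).
- case: (same_shape_cut_kind t2 c2 t1 c1 (same_shape_sym s)).
  by apply: (same_inj s); rewrite f_invF.
- have gq : g q1 = q2.
    apply/eqP; rewrite -(vcut_abut_newr t2' c2) gE -fr (same_abut s).
    by rewrite (vcut_abut_newr t1' c1).
  have sg : same_shape X1' X2' g.
    split=> // i j.
    + by rewrite -(vcut_left_of t1' c1) -(vcut_left_of t2' c2) !gE (same_left_of s).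
    + by rewrite -(vcut_under t1' c1) -(vcut_under t2' c2) !gE (same_under s).
    (* A vertical cut takes from [q1] all its contacts on the right; they are read off the new leaf
       instead. *)
    + have [-> | iq] := eqVneq i q1.
        rewrite gq -(vcut_abut_newl c1) -(vcut_abut_newl c2) gE -fr.
        exact: same_abut.
      have := vcut_abut t1' c1 i j; rewrite iq /= => <-.
      have := vcut_abut t2' c2 (g i) (g j); rewrite -gq (inj_eq ginj) iq /= => <-.
      by rewrite !gE (same_abut s).
  by rewrite (IH _ _ _ _ _ t1' t2' sg cw1 cw2).
Qed.

(** * Segments in coordinates *)

Local Open Scope classical_set_scope.

Lemma interior_region (R : realType) (X : rectangle R) p :
  interior (region X) p <->
  xmin X < p.1 < xmax X /\ ymin X < p.2 < ymax X.
Proof.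
rewrite /interior; split.
  move=> /nbhs_ballP[e /= e0 h].
  have ballE (q : R * R) : `|p.1 - q.1| < e -> `|p.2 - q.2| < e -> region X q.
    by move=> h1 h2; apply: h; split; rewrite -ball_normE.
  have := ballE (p.1 - e / 2, p.2 - e / 2); have := ballE (p.1 + e / 2, p.2 + e / 2).
  rewrite /region /= !opprD !addrA !subrr !add0r !opprK normrN gtr0_norm; last lra.
  move=> /(_ ltac:(lra) ltac:(lra)) [? ?] /(_ ltac:(lra) ltac:(lra)) [? ?].
  by split; lra.
move=> [/andP[h1 h2] /andP[h3 h4]]; apply/nbhs_ballP.
pose e := Num.min (Num.min (p.1 - xmin X) (xmax X - p.1))
  (Num.min (p.2 - ymin X) (ymax X - p.2)).
exists e => /=; first by rewrite /e !lt_min !subr_gt0 h1 h2 h3.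
move=> q [/=]; rewrite -!ball_normE /= /e !lt_min !ltr_norml.
by move=> /andP[/andP[? ?] /andP[? ?]] /andP[/andP[? ?] /andP[? ?]]; split; lra.
Qed.

Lemma sub_vline (R : realType) (a c d a' c' d' : R) : c <= d ->
  vline a c d `<=` vline a' c' d' <-> [/\ a = a', c' <= c & d <= d'].
Proof.
move=> cd; split=> [h | [-> h1 h2] p [p1 p2]]; last by split=> //; lra.
have [|e1 /andP[e2 _]] := h (a, c); first by split=> //=; lra.
have [|_ /andP[_ e3]] := h (a, d); first by split=> //=; lra.
by split.
Qed.

Lemma sub_hline (R : realType) (b e f b' e' f' : R) : e <= f ->
  hline b e f `<=` hline b' e' f' <-> [/\ b = b', e' <= e & f <= f'].
Proof.
move=> ef; split=> [h | [-> h1 h2] p [p1 p2]]; last by split=> //; lra.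
have [|/andP[e2 _] e1] := h (e, b); first by split=> //=; lra.
have [|/andP[_ e3] _] := h (f, b); first by split=> //=; lra.
by split.
Qed.

Lemma not_sub_vline_hline (R : realType) (a c d b e f : R) : c < d ->
  ~ vline a c d `<=` hline b e f.
Proof.
move=> cd h; have [|_ /= e1] := h (a, c); first by split=> //=; lra.
have [|_ /= e2] := h (a, d); first by split=> //=; lra.
by lra.
Qed.

Lemma not_sub_hline_vline (R : realType) (a c d b e f : R) : e < f ->
  ~ hline b e f `<=` vline a c d.
Proof.
move=> ef h; have [|/= e1 _] := h (e, b); first by split=> //=; lra.
have [|/= e2 _] := h (f, b); first by split=> //=; lra.
by lra.
Qed.

Lemma straight_vline (R : realType) (a c d : R) : straight (vline a c d) <-> c < d.
Proof.
split=> [[] | h]; last by left; exists a, c, d.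
  move=> [a' [c' [d' [h E]]]].
  have : vline a' c' d' `<=` vline a c d by rewrite E.
  by rewrite sub_vline; [move=> [_ ? ?] | ]; lra.
move=> [b [e [f [h E]]]].
by case: (@not_sub_hline_vline _ a c d b e f h); rewrite E.
Qed.

Lemma straight_hline (R : realType) (b e f : R) : straight (hline b e f) <-> e < f.
Proof.
split=> [[] | h]; last by right; exists b, e, f.
  move=> [a [c [d [h E]]]].
  by case: (@not_sub_vline_hline _ a c d b e f h); rewrite E.
move=> [b' [e' [f' [h E]]]].
have : hline b' e' f' `<=` hline b e f by rewrite E.
by rewrite sub_hline; [move=> [_ ? ?] | ]; lra.
Qed.

(** What [union_of_sides] amounts to for [vline a c d]: a side inside this line is necessarily
    vertical, and the last clause keeps it inside. *)
Definition vcovered (R : realType) n (X : 'I_n -> rectangle R) (a c d : R) : Prop :=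
  forall y, c <= y <= d -> exists k,
    [/\ a = xmin (X k) \/ a = xmax (X k), ymin (X k) <= y <= ymax (X k)
      & c <= ymin (X k) /\ ymax (X k) <= d].

Definition hcovered (R : realType) n (X : 'I_n -> rectangle R) (b e f : R) : Prop :=
  forall x, e <= x <= f -> exists k,
    [/\ b = ymin (X k) \/ b = ymax (X k), xmin (X k) <= x <= xmax (X k)
      & e <= xmin (X k) /\ xmax (X k) <= f].

Lemma union_of_sides_vline (R : realType) n (D : decomposition R n) a c d :
  union_of_sides D (vline a c d) <-> vcovered (rect D) a c d.
Proof.
split=> [[S Ssides E] y hy | h].
  have : vline a c d (a, y) by split.
  rewrite E => -[s Ss say]; have [k _ sk] := Ssides s Ss; exists k.
  have ssub : s `<=` vline a c d by rewrite E => p sp; exists s.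
  have [hw hh] := (xmin_lt_xmax (rect D k), ymin_lt_ymax (rect D k)).
  case: sk => sE; rewrite sE in say ssub.
  - case: say => /= E1 E2; have /= := (sub_vline _ _ _ _ (ltW hh)).1 ssub.
    by move=> [? ? ?]; split=> //; left.
  - case: say => /= E1 E2; have /= := (sub_vline _ _ _ _ (ltW hh)).1 ssub.
    by move=> [? ? ?]; split=> //; right.
  - by case: (not_sub_hline_vline hw ssub).
  - by case: (not_sub_hline_vline hw ssub).
exists [set s | (\bigcup_i sides (rect D i)) s /\ s `<=` vline a c d].
  by move=> s [].
apply/seteqP; split=> [p pE | p [s [_ sub] sp]]; last exact: sub.
case: pE => p1 p2; have [k [k1 k2 [k3 k4]]] := h p.2 p2.
have hh := ymin_lt_ymax (rect D k).
exists (vline a (ymin (rect D k)) (ymax (rect D k))); last by split.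
split; last by rewrite sub_vline //; lra.
by exists k => //; case: k1 => ->; [constructor 1 | constructor 2].
Qed.

Lemma union_of_sides_hline (R : realType) n (D : decomposition R n) b e f :
  union_of_sides D (hline b e f) <-> hcovered (rect D) b e f.
Proof.
split=> [[S Ssides E] x hx | h].
  have : hline b e f (x, b) by split.
  rewrite E => -[s Ss say]; have [k _ sk] := Ssides s Ss; exists k.
  have ssub : s `<=` hline b e f by rewrite E => p sp; exists s.
  have [hw hh] := (xmin_lt_xmax (rect D k), ymin_lt_ymax (rect D k)).
  case: sk => sE; rewrite sE in say ssub.
  - by case: (not_sub_vline_hline hh ssub).
  - by case: (not_sub_vline_hline hh ssub).
  - case: say => /= E1 E2; have /= := (sub_hline _ _ _ _ (ltW hw)).1 ssub.
    by move=> [? ? ?]; split=> //; left.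
  - case: say => /= E1 E2; have /= := (sub_hline _ _ _ _ (ltW hw)).1 ssub.
    by move=> [? ? ?]; split=> //; right.
exists [set s | (\bigcup_i sides (rect D i)) s /\ s `<=` hline b e f].
  by move=> s [].
apply/seteqP; split=> [p pE | p [s [_ sub] sp]]; last exact: sub.
case: pE => p1 p2; have [k [k1 k2 [k3 k4]]] := h p.1 p1.
have hw := xmin_lt_xmax (rect D k).
exists (hline b (xmin (rect D k)) (xmax (rect D k))); last by split.
split; last by rewrite sub_hline //; lra.
by exists k => //; case: k1 => ->; [constructor 3 | constructor 4].
Qed.

Lemma boundaryP (R : realType) (X : rectangle R) p : boundary X p <->
  (p.1 = xmin X \/ p.1 = xmax X) /\ ymin X <= p.2 <= ymax X \/
  (p.2 = ymin X \/ p.2 = ymax X) /\ xmin X <= p.1 <= xmax X.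
Proof.
split=> [[s [] -> []] | [[[] h1 h2] | [[] h1 h2]]]; try by tauto.
- by exists (left_side X); [constructor 1 | split].
- by exists (right_side X); [constructor 2 | split].
- by exists (bottom_side X); [constructor 3 | split].
- by exists (top_side X); [constructor 4 | split].
Qed.

Lemma vline_sub_boundary (R : realType) (X : rectangle R) a c d : c < d ->
  vline a c d `<=` boundary X <->
  (a = xmin X \/ a = xmax X) /\ ymin X <= c /\ d <= ymax X.
Proof.
move=> cd; split=> [h | [h1 [h2 h3]] p [p1 p2]]; last first.
  by apply/boundaryP; left; rewrite p1; split=> //; lra.
have hy y : c <= y <= d -> boundary X (a, y) by move=> ?; apply: h; split.
have hb y : c <= y <= d -> ymin X <= y <= ymax X.
  move=> /hy/boundaryP[[_] | [] /= [] -> _] //; have := ymin_lt_ymax X; lra.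
have a1 : a = xmin X \/ a = xmax X.
  (* Off both vertical sides, the boundary has only two possible heights; the two ends and the
     midpoint give three. *)
  have [||[]] := (boundaryP X (a, c)).1 (hy c _); [lra | by tauto | move=> /= h1 _].
  have [||[]] := (boundaryP X (a, d)).1 (hy d _); [lra | by tauto | move=> /= h2 _].
  have [||[]] := (boundaryP X (a, (c + d) / 2)).1 (hy ((c + d) / 2) _);
    [lra | by tauto | move=> /= h3 _].
  by exfalso; case: h1 h2 h3 => [] ? [] ? [] ?; lra.
by split=> //; have := hb c; have := hb d; lra.
Qed.

Lemma hline_sub_boundary (R : realType) (X : rectangle R) b e f : e < f ->
  hline b e f `<=` boundary X <->
  (b = ymin X \/ b = ymax X) /\ xmin X <= e /\ f <= xmax X.
Proof.
move=> ef; split=> [h | [h1 [h2 h3]] p [p1 p2]]; last first.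
  by apply/boundaryP; right; rewrite p2; split=> //; lra.
have hx x : e <= x <= f -> boundary X (x, b) by move=> ?; apply: h; split.
have hb x : e <= x <= f -> xmin X <= x <= xmax X.
  move=> /hx/boundaryP[[] /= [] -> _ | [_]] //; have := xmin_lt_xmax X; lra.
have b1 : b = ymin X \/ b = ymax X.
  have [|[]|] := (boundaryP X (e, b)).1 (hx e _); [lra | move=> /= h1 _ | by tauto].
  have [|[]|] := (boundaryP X (f, b)).1 (hx f _); [lra | move=> /= h2 _ | by tauto].
  have [|[]|] := (boundaryP X ((e + f) / 2, b)).1 (hx ((e + f) / 2) _);
    [lra | move=> /= h3 _ | by tauto].
  by exfalso; case: h1 h2 h3 => [] ? [] ? [] ?; lra.
by split=> //; have := hb e; have := hb f; lra.
Qed.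

Lemma decomposition_in_outer (R : realType) n (D : decomposition R n) i :
  [/\ xmin (outer D) <= xmin (rect D i), xmax (rect D i) <= xmax (outer D),
    ymin (outer D) <= ymin (rect D i) & ymax (rect D i) <= ymax (outer D)].
Proof.
have [hw hh] := (xmin_lt_xmax (rect D i), ymin_lt_ymax (rect D i)).
have sub p : region (rect D i) p -> region (outer D) p.
  by move=> h; rewrite -rect_cover; exists i.
have [|/= h1 h2] := sub (xmin (rect D i), ymin (rect D i)); first by split => /=; lra.
have [|/= h3 h4] := sub (xmax (rect D i), ymax (rect D i)); first by split => /=; lra.
by split; lra.
Qed.

Lemma segment_vline (R : realType) n (D : decomposition R n) a c d :
  segment D (vline a c d) <->
  [/\ c < d, xmin (outer D) < a < xmax (outer D), vcovered (rect D) a c d &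
    forall c' d', c' <= c -> d <= d' -> vcovered (rect D) a c' d' ->
      c' = c /\ d' = d].
Proof.
split=> [[/straight_vline cd /union_of_sides_vline uc nb mx] | [cd ha uc mx]].
  have [|k [k1 k2 [k3 k4]]] := uc c; first lra.
  have [|k' [k1' k2' [k3' k4']]] := uc d; first lra.
  have [o1 o2 o3 o4] := decomposition_in_outer D k.
  have [o1' o2' o3' o4'] := decomposition_in_outer D k'.
  have hw := xmin_lt_xmax (rect D k).
  split=> //.
    rewrite !lt_neqAle; apply/andP; split; apply/andP; split;
      try (by case: k1; lra); apply/eqP => aE; case: nb;
      apply/(vline_sub_boundary _ _ cd); split; by [lra | rewrite aE; tauto].
  move=> c' d' h1 h2 uc'.
  have cd' : c' < d' by lra.
  have E : vline a c' d' = vline a c d.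
    apply: mx; [exact/straight_vline | exact/union_of_sides_vline |].
    by rewrite sub_vline //; lra.
  have : vline a c' d' `<=` vline a c d by rewrite E.
  by rewrite sub_vline; [move=> [_ ? ?]; split | ]; lra.
split; first exact/straight_vline.
- exact/union_of_sides_vline.
- by move=> /(vline_sub_boundary _ _ cd)[]; lra.
- move=> t [] [x [y [z [h ->]]]].
    move=> /union_of_sides_vline uc'; rewrite sub_vline; last exact: ltW.
    move=> [aE h1 h2].
    by rewrite -aE in uc' *; have [-> ->] := mx _ _ h1 h2 uc'.
  by move=> _ /(not_sub_vline_hline cd).
Qed.

Lemma segment_hline (R : realType) n (D : decomposition R n) b e f :
  segment D (hline b e f) <->
  [/\ e < f, ymin (outer D) < b < ymax (outer D), hcovered (rect D) b e f &
    forall e' f', e' <= e -> f <= f' -> hcovered (rect D) b e' f' ->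
      e' = e /\ f' = f].
Proof.
split=> [[/straight_hline ef /union_of_sides_hline uc nb mx] | [ef hb uc mx]].
  have [|k [k1 k2 [k3 k4]]] := uc e; first lra.
  have [|k' [k1' k2' [k3' k4']]] := uc f; first lra.
  have [o1 o2 o3 o4] := decomposition_in_outer D k.
  have [o1' o2' o3' o4'] := decomposition_in_outer D k'.
  have hh := ymin_lt_ymax (rect D k).
  split=> //.
    rewrite !lt_neqAle; apply/andP; split; apply/andP; split;
      try (by case: k1; lra); apply/eqP => bE; case: nb;
      apply/(hline_sub_boundary _ _ ef); split; by [lra | rewrite bE; tauto].
  move=> e' f' h1 h2 uc'.
  have ef' : e' < f' by lra.
  have E : hline b e' f' = hline b e f.
    apply: mx; [exact/straight_hline | exact/union_of_sides_hline |].
    by rewrite sub_hline //; lra.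
  have : hline b e' f' `<=` hline b e f by rewrite E.
  by rewrite sub_hline; [move=> [_ ? ?]; split | ]; lra.
split; first exact/straight_hline.
- exact/union_of_sides_hline.
- by move=> /(hline_sub_boundary _ _ ef)[]; lra.
- move=> t [] [x [y [z [h ->]]]].
    by move=> _ /(not_sub_hline_vline ef).
  move=> /union_of_sides_hline uc'; rewrite sub_hline; last exact: ltW.
  move=> [bE h1 h2].
  by rewrite -bE in uc' *; have [-> ->] := mx _ _ h1 h2 uc'.
Qed.

(** The ends of a covered line are floors and tops of rectangles, so there are finitely many
    candidates, and a longest one is a segment. *)
Lemma vertical_extend (R : realType) n (D : decomposition R n) a c d :
  c < d -> xmin (outer D) < a < xmax (outer D) -> vcovered (rect D) a c d ->
  exists c' d', [/\ segment D (vline a c' d'), c' <= c & d <= d'].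
Proof.
move=> cd ha uc; pose X := rect D.
pose P (jk : 'I_n * 'I_n) := `[< [/\ vcovered X a (ymin (X jk.1)) (ymax (X jk.2)),
  ymin (X jk.1) <= c & d <= ymax (X jk.2)] >].
have ends c' d' : c' < d' -> vcovered X a c' d' ->
    exists j k, c' = ymin (X j) /\ d' = ymax (X k).
  move=> cd' uc'; have [|j [j1 j2 [j3 j4]]] := uc' c'; first lra.
  have [|k [k1 k2 [k3 k4]]] := uc' d'; first lra.
  by exists j, k; split; lra.
have [j0 [k0 [j0E k0E]]] := ends _ _ cd uc.
have P0 : P (j0, k0) by apply/asboolP => /=; rewrite -j0E -k0E; split.
case: (@arg_maxP _ _ _ (j0, k0) P (fun jk => ymax (X jk.2) - ymin (X jk.1)) P0).
move=> [j k] /asboolP[/= ujk h1 h2] mx.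
exists (ymin (X j)), (ymax (X k)); split=> //; apply/segment_vline; split=> //.
  by lra.
move=> c' d' h3 h4 uc'; have cd' : c' < d' by lra.
have [j' [k' [j'E k'E]]] := ends _ _ cd' uc'.
have P' : P (j', k') by apply/asboolP => /=; rewrite -j'E -k'E; split=> //; lra.
have /= : ymax (X k') - ymin (X j') <= ymax (X k) - ymin (X j) := mx _ P'.
by rewrite -j'E -k'E; split; lra.
Qed.

Lemma horizontal_extend (R : realType) n (D : decomposition R n) b e f :
  e < f -> ymin (outer D) < b < ymax (outer D) -> hcovered (rect D) b e f ->
  exists e' f', [/\ segment D (hline b e' f'), e' <= e & f <= f'].
Proof.
move=> ef hb uc; pose X := rect D.
pose P (jk : 'I_n * 'I_n) := `[< [/\ hcovered X b (xmin (X jk.1)) (xmax (X jk.2)),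
  xmin (X jk.1) <= e & f <= xmax (X jk.2)] >].
have ends e' f' : e' < f' -> hcovered X b e' f' ->
    exists j k, e' = xmin (X j) /\ f' = xmax (X k).
  move=> ef' uc'; have [|j [j1 j2 [j3 j4]]] := uc' e'; first lra.
  have [|k [k1 k2 [k3 k4]]] := uc' f'; first lra.
  by exists j, k; split; lra.
have [j0 [k0 [j0E k0E]]] := ends _ _ ef uc.
have P0 : P (j0, k0) by apply/asboolP => /=; rewrite -j0E -k0E; split.
case: (@arg_maxP _ _ _ (j0, k0) P (fun jk => xmax (X jk.2) - xmin (X jk.1)) P0).
move=> [j k] /asboolP[/= ujk h1 h2] mx.
exists (xmin (X j)), (xmax (X k)); split=> //; apply/segment_hline; split=> //.
  by lra.
move=> e' f' h3 h4 uc'; have ef' : e' < f' by lra.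
have [j' [k' [j'E k'E]]] := ends _ _ ef' uc'.
have P' : P (j', k') by apply/asboolP => /=; rewrite -j'E -k'E; split=> //; lra.
have /= : xmax (X k') - xmin (X j') <= xmax (X k) - xmin (X j) := mx _ P'.
by rewrite -j'E -k'E; split; lra.
Qed.

(** * From decompositions to coordinates and back *)

Lemma decomposition_apart (R : realType) n (D : decomposition R n) i j :
  xmin (rect D i) < xmax (rect D j) -> xmin (rect D j) < xmax (rect D i) ->
  ymin (rect D i) < ymax (rect D j) -> ymin (rect D j) < ymax (rect D i) -> i = j.
Proof.
move=> h1 h2 h3 h4; apply/eqP; apply: contraT => ij.
have mid (p q r s : R) : p < q -> p < s -> r < q -> r < s ->
    exists2 x, p < x < q & r < x < s.
  move=> *; exists ((Num.max p r + Num.min q s) / 2);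
    by case: (leP p r); case: (leP q s); lra.
have [xi yi] := (xmin_lt_xmax (rect D i), ymin_lt_ymax (rect D i)).
have [xj yj] := (xmin_lt_xmax (rect D j), ymin_lt_ymax (rect D j)).
have [x x1 x2] := mid _ _ _ _ xi h1 h2 xj.
have [y y1 y2] := mid _ _ _ _ yi h3 h4 yj.
have : (interior (region (rect D i)) `&` interior (region (rect D j))) (x, y).
  by split; apply/interior_region.
by rewrite rect_disjoint.
Qed.

(** Used to pass from the closed cover to the half-open one: a closed rectangle containing a point
    slightly to the right, before the next left side, also contains [x] and does not end there. *)
Lemma gap_right (R : realType) n (c : 'I_n -> R) x x1 : x < x1 ->
  exists2 x', x < x' < x1 & forall k, x < c k -> x' < c k.
Proof.
elim: n c => [|n IH] c h; first by exists ((x + x1) / 2) => [|[]//]; lra.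
have [x' h1 h2] := IH (fun k => c (lift ord0 k)) h.
have [h3 | h3] := leP (c ord0) x.
  exists x' => // k; case: (unliftP ord0 k) => [k' -> | ->]; last by lra.
  exact: h2.
exists ((x + Num.min x' (c ord0)) / 2); first by case: (leP x' (c ord0)); lra.
move=> k; case: (unliftP ord0 k) => [k' -> /h2 /= | -> _]; by case: (leP x' (c ord0)); lra.
Qed.

Lemma gap_left (R : realType) n (c : 'I_n -> R) x0 x : x0 < x ->
  exists2 x', x0 < x' < x & forall k, c k < x -> c k < x'.
Proof.
move=> h; have [|x' h1 h2] := @gap_right _ n (fun k => - c k) (- x) (- x0); first lra.
by exists (- x') => [|k hk]; [lra | have := h2 k; lra].
Qed.

Lemma bottomed_of_decomposition (R : realType) n (D : rectangulation R n) :
  verticals_on_bottom D -> bottomed (outer D) (rect D).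
Proof.
move=> vob; pose X := rect D.
have inO i := decomposition_in_outer D i.
have wall a i : xmin (outer D) < a < xmax (outer D) ->
    a = xmin (X i) \/ a = xmax (X i) ->
    exists c d, [/\ c = ymin (outer D), segment D (vline a c d), vcovered X a c d,
      c <= ymin (X i) & ymax (X i) <= d].
  move=> ha ai; have hi := ymin_lt_ymax (X i).
  have uc : vcovered X a (ymin (X i)) (ymax (X i)).
    by move=> y hy; exists i; split=> //; lra.
  have [c [d [sg h1 h2]]] := vertical_extend hi ha uc.
  have [_ cE] := vob _ _ _ sg; exists c, d; split=> //.
  by have /segment_vline[] := sg.
(* If [j] started below the top of [i], the wall would pass through the interior of [j], and a
   rectangle with its side there would overlap [j]. *)
have high a i j : xmin (X j) < a -> a < xmax (X j) ->
    a = xmin (X i) \/ a = xmax (X i) -> ymax (X i) <= ymin (X j).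
  move=> h1 h2 ai; rewrite leNgt; apply/negP => h3.
  have [o1 o2 o3 o4] := inO j; have [p1 p2 p3 p4] := inO i.
  have [|c [d [cE _ uc h4 h5]]] := @wall a i _ ai; first lra.
  have hj := ymin_lt_ymax (X j).
  pose y := (ymin (X j) + Num.min (ymax (X i)) (ymax (X j))) / 2.
  have hy : [/\ ymin (X j) < y, y < ymax (X i) & y < ymax (X j)].
    by rewrite /y; case: (leP (ymax (X i)) (ymax (X j))); split; lra.
  case: hy => y1 y2 y3; have [|k [k1 k2 _]] := uc y; first by rewrite cE; lra.
  have wk := xmin_lt_xmax (X k).
  have E : k = j by apply: (@decomposition_apart _ _ D); case: k1; lra.
  by rewrite E in k1; case: k1; lra.
split.
- by move=> i; case: (inO i).
- by move=> i; case: (inO i).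
- by move=> i; case: (inO i).
- by move=> i; case: (inO i).
- exact: decomposition_apart.
- move=> x y hx hy; have [x1 y1] := (andP hx, andP hy).
  have [x' hx' gx] := @gap_right _ n (fun k => xmin (X k)) x _ x1.2.
  have [y' hy' gy] := @gap_right _ n (fun k => ymin (X k)) y _ y1.2.
  have : region (outer D) (x', y') by split=> /=; lra.
  rewrite -rect_cover => -[k _ [/= kx ky]]; exists k; rewrite -/(X k) in kx ky *.
  split; apply/andP; split; try by lra.
    by rewrite leNgt; apply/negP => /gx; lra.
  by rewrite leNgt; apply/negP => /gy; lra.
- by move=> i j h1 h2; apply: (high (xmin (X i))) => //; left.
- by move=> i j h1 h2; apply: (high (xmax (X i))) => //; right.
- move=> i j E Eb; apply/eqP; apply: contraT => ne.
  have [wi wj] := (xmin_lt_xmax (X i), xmin_lt_xmax (X j)).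
  have hi := ymin_lt_ymax (X i).
  have [o1 o2 o3 o4] := inO j; have [p1 p2 p3 p4] := inO i; rewrite -!/(X _) in E Eb ne o1 o2 o3 o4 p1 p2 p3 p4 *.
  have hb : ymin (outer D) < ymin (X i) by rewrite lt_neqAle eq_sym ne.
  have [||c [d [cE sv _ h4 h5]]] := @wall (xmax (X i)) i; [lra | by right |].
  (* The two floors form one horizontal line, which extends to a segment crossing the wall between
     [i] and [j], against genericity. *)
  have [|||e [f [sh h6 h7]]] :=
      @horizontal_extend _ _ D (ymin (X i)) (xmin (X i)) (xmax (X j)); try lra.
    move=> x hx; have [h | h] := leP x (xmax (X i)).
      by exists i; split; [by left | lra | lra].
    by exists j; rewrite -/(X j); split; [by left | lra | lra].
  by case: (decomp_generic sv sh); lra.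
Qed.

(** The half-open cover misses the right and upper sides of the outer rectangle. A point there is
    moved inwards, but stays beyond every end [d k] smaller than [x1], so what covers the moved
    point reaches the original one. *)
Lemma clamp_left (R : realType) n (c d : 'I_n -> R) x0 x1 x :
  x0 < x1 -> x0 <= x <= x1 -> (forall k, d k <= x1) ->
  exists2 x', x0 <= x' < x1 & forall k, c k <= x' < d k -> c k <= x <= d k.
Proof.
move=> h01 hx dx; have [h | h] := ltP x x1; first by exists x => [|k ?]; lra.
have [x' h1 h2] := gap_left d h01; exists x' => [|k hk]; first lra.
have := dx k; have [/h2 | h3] := ltP (d k) x1; lra.
Qed.

Lemma bottomed_region (R : realType) n (O : rectangle R) (X : 'I_n -> rectangle R)
  (tX : bottomed O X) : \bigcup_i region (X i) = region O.
Proof.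
apply/seteqP; split=> [[x y] [i _ [/= hx hy]] | [x y] [/= hx hy]].
  have := bottomed_xmin tX i; have := bottomed_xmax tX i.
  by have := bottomed_ymin tX i; have := bottomed_ymax tX i; split => /=; lra.
have [x' hx' gx] := clamp_left (fun k => xmin (X k)) (xmin_lt_xmax O) hx (bottomed_xmax tX).
have [y' hy' gy] := clamp_left (fun k => ymin (X k)) (ymin_lt_ymax O) hy (bottomed_ymax tX).
have [k [kx ky]] := bottomed_cover tX hx' hy'.
by exists k => //; split; [exact: gx | exact: gy].
Qed.

Lemma bottomed_disjoint (R : realType) n (O : rectangle R) (X : 'I_n -> rectangle R)
  (tX : bottomed O X) i j : i != j ->
  interior (region (X i)) `&` interior (region (X j)) = set0.
Proof.
move=> ij; apply/seteqP; split=> // p [/interior_region pi /interior_region pj].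
by case/eqP: ij; apply: (bottomed_apart tX); lra.
Qed.

(** Below the top of the highest rectangle [k] with a side on the line, each height has a neighbour
    across that side or its extension, again with a side on the line; so there is no gap down to the
    bottom. *)
Lemma wall_segment (R : realType) n (D : decomposition R n)
    (tX : bottomed (outer D) (rect D)) a i :
  xmin (outer D) < a < xmax (outer D) ->
  a = xmin (rect D i) \/ a = xmax (rect D i) ->
  exists k, [/\ segment D (vline a (ymin (outer D)) (ymax (rect D k))),
    a = xmin (rect D k) \/ a = xmax (rect D k) &
    forall j, a = xmin (rect D j) \/ a = xmax (rect D j) ->
      ymax (rect D j) <= ymax (rect D k)].
Proof.
move=> ha ai; set X := rect D in tX ai *.
pose P k := (a == xmin (X k)) || (a == xmax (X k)).
have PP k : a = xmin (X k) \/ a = xmax (X k) <-> P k.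
  rewrite /P; split=> [[] /eqP -> | /orP[] /eqP E]; rewrite ?orbT //.
    by left.
  by right.
case: (@arg_maxP _ _ _ i P (fun k => ymax (X k)) ((PP i).1 ai)) => k Pk kmax.
have {}kmax j : a = xmin (X j) \/ a = xmax (X j) -> ymax (X j) <= ymax (X k).
  by move=> /PP Pj; exact: kmax.
have {Pk} ak := (PP k).2 Pk; exists k; split=> //.
have hk := ymin_lt_ymax (X k); have bk := bottomed_ymin tX k.
have covered y : ymin (outer D) <= y < ymax (X k) ->
    exists j, (a = xmin (X j) \/ a = xmax (X j)) /\ ymin (X j) <= y <= ymax (X j).
  move=> hy; case: ak => ak.
    have [||j [j1 j2]] := @bottomed_left_neighbour _ _ _ _ tX k y; try lra.
    by exists j; split; [right; rewrite j1 | lra].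
  have [||j [j1 j2]] := @bottomed_right_neighbour _ _ _ _ tX k y; try lra.
  by exists j; split; [left; rewrite j1 | lra].
apply/segment_vline; split=> //; first lra.
  move=> y hy; have [h | h] := ltP y (ymax (X k)); last by exists k; split=> //; lra.
  have [|j [j1 j2]] := covered y; first lra.
  by exists j; split=> //; have := bottomed_ymin tX j; have := kmax _ j1; lra.
move=> c d hc hd uc.
have [|j [j1 j2 [j3 j4]]] := uc c; first lra.
have [|m [m1 m2 [m3 m4]]] := uc d; first lra.
by have := bottomed_ymin tX j; have := kmax _ m1; rewrite -!/(X _) in j2 m2 *; lra.
Qed.

Lemma segment_vline_bottomed (R : realType) n (D : decomposition R n)
    (tX : bottomed (outer D) (rect D)) a c d :
  segment D (vline a c d) -> c = ymin (outer D) /\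
  exists2 k, a = xmin (rect D k) \/ a = xmax (rect D k) & d = ymax (rect D k).
Proof.
move=> /segment_vline[cd ha uc mx].
have [|i [ai _ [ci _]]] := uc c; first lra.
have [k [/segment_vline[_ _ uck _] ak kmax]] := wall_segment tX ha ai.
have [|j [j1 j2 [j3 j4]]] := uc d; first lra.
have [||<- <-] := mx _ _ _ _ uck; last by split=> //; exists k.
  by have := bottomed_ymin tX i; have [|m [_ ? [? _]]] := uc c; [lra|]; have := bottomed_ymin tX m; lra.
by have := kmax _ j1; lra.
Qed.

(** Otherwise the line would run through the interior of [j], and a rectangle with its floor or top
    there would overlap [j]. *)
Lemma hcovered_floor (R : realType) n (D : decomposition R n)
    (tX : bottomed (outer D) (rect D)) b e f j :
  hcovered (rect D) b e f -> e < xmax (rect D j) -> xmin (rect D j) < f -> e < f ->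
  ymin (rect D j) <= b < ymax (rect D j) -> ymin (rect D j) = b.
Proof.
set X := rect D in tX * => uc h1 h2 h3 hb.
have wj := xmin_lt_xmax (X j).
pose x := (Num.max e (xmin (X j)) + Num.min f (xmax (X j))) / 2.
have [hx hxj] : e <= x <= f /\ xmin (X j) < x < xmax (X j).
  by rewrite /x; case: (leP e (xmin (X j))); case: (leP f (xmax (X j))); split; lra.
have [k [k1 k2 _]] := uc x hx; apply/eqP; apply: contraT => ne.
have {ne} lt : ymin (X j) < b by rewrite lt_neqAle ne; lra.
have hk := ymin_lt_ymax (X k).
have E : k = j by apply: (bottomed_apart tX); case: k1; lra.
by rewrite E in k1; case: k1; lra.
Qed.

Lemma generic_of_bottomed (R : realType) n (D : decomposition R n)
    (tX : bottomed (outer D) (rect D)) : generic D.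
Proof.
move=> a c d b e f sv sh [ea cb].
have [cE [k0 ak0 dE]] := segment_vline_bottomed tX sv.
have /segment_hline[ef hb uc _] := sh; have /segment_vline[cd ha _ _] := sv.
set X := rect D in tX ak0 dE uc *.
(* At the crossing point, [j] and [k] are the rectangles just above it on the right and on the left;
   both must have their floor on the horizontal segment, against [bottomed_nocross]. *)
have [j [k [jE kE jb kb]]] : exists j k, [/\ xmin (X j) = a, xmax (X k) = a,
    ymin (X j) <= b < ymax (X j) & ymin (X k) <= b < ymax (X k)].
  case: ak0 => ak0.
    have [||k [k1 k2]] := @bottomed_left_neighbour _ _ _ _ tX k0 b; try lra.
    have [||j [j1 j2]] := @bottomed_right_neighbour _ _ _ _ tX k b; try lra.
    by exists j, k; split; lra.
  have [||j [j1 j2]] := @bottomed_right_neighbour _ _ _ _ tX k0 b; try lra.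
  have [||k [k1 k2]] := @bottomed_left_neighbour _ _ _ _ tX j b; try lra.
  by exists j, k; split; lra.
have [wj wk] := (xmin_lt_xmax (X j), xmin_lt_xmax (X k)).
have bj : ymin (X j) = b by apply: (hcovered_floor tX uc); rewrite -/X; lra.
have bk : ymin (X k) = b by apply: (hcovered_floor tX uc); rewrite -/X; lra.
by have := @bottomed_nocross _ _ _ _ tX k j; rewrite kE jE bj bk => /(_ erefl erefl); lra.
Qed.

Lemma rectangulation_of_bottomed (R : realType) n (O : rectangle R)
    (X : 'I_n -> rectangle R) (tX : bottomed O X) :
  exists D : rectangulation R n,
    [/\ outer D = O, rect D = X & verticals_on_bottom D].
Proof.
pose D := Decomposition (bottomed_region tX) (bottomed_disjoint tX).
have tD : bottomed (outer D) (rect D) by [].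
exists (Rectangulation (generic_of_bottomed tD)); split=> // a c d sg.
have [-> _] := segment_vline_bottomed tD sg.
by have /segment_vline[_ ha _ _] := sg; split=> //=; move: ha => /=; lra.
Qed.

(** * Strong equivalence in coordinates *)

(** An inner vertical line carries a single segment, from the bottom to its highest side, so all
    sides on that line share it. *)
Lemma right_stepP (R : realType) n (D : decomposition R n)
    (tX : bottomed (outer D) (rect D)) i j :
  right_step D i j <-> xmax (rect D i) = xmin (rect D j).
Proof.
set X := rect D in tX *; have [hi hj] := (ymin_lt_ymax (X i), ymin_lt_ymax (X j)).
split=> [[s [_ [a [c [d [_ ->]]]]]] | E].
  move=> /(sub_vline _ _ _ _ (ltW hi))[aE _ _].
  by move=> /(sub_vline _ _ _ _ (ltW hj))[aE' _ _]; rewrite aE aE'.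
have [wi wj] := (xmin_lt_xmax (X i), xmin_lt_xmax (X j)).
have [oi oj] := (bottomed_xmin tX i, bottomed_xmax tX j).
have [bi bj] := (bottomed_ymin tX i, bottomed_ymin tX j).
have [||k [sg ak mx]] := @wall_segment _ _ D tX (xmax (X i)) i; [lra | by right |].
have := mx i (or_intror erefl); have := mx j (or_introl E); rewrite -!/(X _) => mj mi.
exists (vline (xmax (X i)) (ymin (outer D)) (ymax (X k))); split=> //.
- by exists (xmax (X i)), (ymin (outer D)), (ymax (X k)); split=> //; lra.
- by rewrite sub_vline; [split; lra | lra].
- by rewrite sub_vline; [split=> //; lra | lra].
Qed.

(** A chain can run through leaves: the leaf starting at the right side of [i] ends before [j],
    since otherwise the wall below the left side of [j] would cut it. The number of rectangles
    starting right of the current one decreases. *)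
Lemma right_ofP (R : realType) n (D : decomposition R n)
    (tX : bottomed (outer D) (rect D)) i j :
  right_of D i j = (i == j) || left_of (rect D) i j.
Proof.
set X := rect D in tX *.
apply/connectP/orP => [[p pth ->] | [/eqP -> | h]]; last 2 first.
- by exists [::].
- have [m] := ubnP #|[pred k | xmin (X k) >= xmax (X i)]|.
  elim: m i h => // m IH i h hm.
  have [wi wj] := (xmin_lt_xmax (X i), xmin_lt_xmax (X j)).
  rewrite /left_of in h; have [E | ne] := eqVneq (xmax (X i)) (xmin (X j)).
    by exists [:: j] => //=; rewrite andbT; apply/asboolP/right_stepP.
  have [|k lk kE] := @leaf_right _ _ _ _ tX i.
    by have := bottomed_xmax tX j; lra.
  have wk := xmin_lt_xmax (X k).
  have hk : xmax (X k) <= xmin (X j).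
    rewrite leNgt; apply/negP => h'; have hj := ymin_lt_ymax (X j).
    have := @bottomed_wall_min _ _ _ _ tX j k; move/eqP: lk => lk.
    have bj := bottomed_ymin tX j.
    have : xmin (X k) < xmin (X j) by rewrite -kE lt_neqAle ne.
    by move=> h1 /(_ h1 h'); lra.
  have [|p pth pE] := IH k hk.
    rewrite -ltnS; apply: leq_trans hm; rewrite ltnS.
    apply: proper_card; apply/fintype.properP; split.
      by apply/fintype.subsetP => z; rewrite !inE; lra.
    by exists k; rewrite !inE; lra.
  exists (k :: p) => //=; rewrite pth andbT; apply/asboolP/right_stepP => //.
elim: p i pth => [|k p IH] i /=; first by left.
move=> /andP[/asboolP/(right_stepP tX) E /IH h]; right; rewrite /left_of.
have wk := xmin_lt_xmax (X k); rewrite -/(X _) in E *.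
case: h => [/eqP <- | ]; first by rewrite E.
by rewrite /left_of -/X; lra.
Qed.

Definition on_top (R : realType) n (X : 'I_n -> rectangle R) (i j : 'I_n) :=
  (ymax (X i) == ymin (X j)) && under X i j.

(** A longer line would continue along a neighbour with an equal floor, which [bottomed_nocross]
    permits only at the bottom; so a floor is already maximal. *)
Lemma bottom_side_segment (R : realType) n (D : decomposition R n)
    (tX : bottomed (outer D) (rect D)) j :
  ymin (outer D) < ymin (rect D j) -> segment D (bottom_side (rect D j)).
Proof.
set X := rect D in tX * => hb.
have [wj hj] := (xmin_lt_xmax (X j), ymin_lt_ymax (X j)).
apply/segment_hline; split=> //.
- by have := bottomed_ymax tX j; lra.
- by move=> x hx; exists j; split=> //; by left.
move=> e f he hf uc.
have [|k [_ ek _]] := uc e; first lra.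
have [|m [_ mf _]] := uc f; first lra.
have [ok om] := (bottomed_xmin tX k, bottomed_xmax tX m).
rewrite -!/(X _) in ek mf ok om.
split; apply/eqP; apply: contraT => ne; exfalso.
  have {}ne : e < xmin (X j) by rewrite lt_neqAle ne.
  have [||z [z1 z2]] := @bottomed_left_neighbour _ _ _ _ tX j (ymin (X j)); try lra.
  have wz := xmin_lt_xmax (X z).
  have bz : ymin (X z) = ymin (X j).
    by apply: (hcovered_floor tX uc); rewrite -/X; lra.
  by have := bottomed_nocross tX z1 bz; lra.
have {}ne : xmax (X j) < f by rewrite lt_neqAle eq_sym ne.
have [||z [z1 z2]] := @bottomed_right_neighbour _ _ _ _ tX j (ymin (X j)); try lra.
have wz := xmin_lt_xmax (X z).
have bz : ymin (X z) = ymin (X j).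
  by apply: (hcovered_floor tX uc); rewrite -/X; lra.
by have := bottomed_nocross tX (esym z1) (esym bz); lra.
Qed.

Lemma above_stepP (R : realType) n (D : decomposition R n)
    (tX : bottomed (outer D) (rect D)) i j :
  above_step D i j <-> on_top (rect D) i j.
Proof.
set X := rect D in tX *; have [wi wj] := (xmin_lt_xmax (X i), xmin_lt_xmax (X j)).
have [hi bi] := (ymin_lt_ymax (X i), bottomed_ymin tX i).
split=> [[s [sg [b [e [f [_ sE]]]]]] | /andP[/eqP E /and3P[_ h2 h3]]].
  rewrite sE in sg * => /(sub_hline _ _ _ _ (ltW wi))[bE e1 f1] hj.
  have [bE' e2 f2] := (sub_hline _ _ _ _ (ltW wj)).1 hj; rewrite -!/(X _) in bE bE' *.
  have [_ _ _ mx] := @bottom_side_segment _ _ D tX j ltac:(rewrite -/X; lra).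
  case: sg => st uc _ _; have Es := mx _ st uc hj.
  have : hline b e f `<=` bottom_side (X j) by rewrite Es.
  rewrite sub_hline; last by lra.
  by move=> [_ ? ?]; apply/andP; split; [apply/eqP | apply/and3P; split]; lra.
exists (bottom_side (X j)); split=> //.
- by apply: (bottom_side_segment tX); rewrite -/X; lra.
- by exists (ymin (X j)), (xmin (X j)), (xmax (X j)).
- by rewrite sub_hline; [split | lra].
Qed.

Lemma under_parent (R : realType) n (O : rectangle R) (X : 'I_n -> rectangle R)
    (tX : bottomed O X) i j : under X i j ->
  exists2 p, on_top X i p & (p == j) || under X p j.
Proof.
move=> /and3P[h1 h2 h3]; have hj := ymin_lt_ymax (X j).
have [|p [p1 p2 p3]] := @bottomed_parent _ _ _ _ tX i.
  by have := bottomed_ymax tX j; lra.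
have wi := xmin_lt_xmax (X i); have hp := ymin_lt_ymax (X p).
exists p; first by rewrite /on_top p1 eqxx /=; apply/and3P; split=> //; lra.
have [// | pj] := eqVneq p j.
have hpj : ymax (X p) <= ymin (X j).
  by rewrite leNgt; apply/negP => h; case/eqP: pj; apply: (bottomed_apart tX); lra.
have [||h4 h5] := bottomed_below tX hpj; try lra.
by apply/and3P; split.
Qed.

Lemma aboveP (R : realType) n (D : decomposition R n)
    (tX : bottomed (outer D) (rect D)) i j :
  above D i j = (i == j) || under (rect D) i j.
Proof.
set X := rect D in tX *.
apply/connectP/orP => [[p pth ->] | [/eqP -> | h]]; last 2 first.
- by exists [::].
- have [m] := ubnP #|[pred k | ymin (X k) >= ymax (X i)]|.
  elim: m i h => // m IH i h hm.
  have [k ik /orP[/eqP kj | kj]] := under_parent tX h.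
    by exists [:: j] => //=; rewrite andbT -kj; apply/asboolP/(above_stepP tX).
  have [|p pth pE] := IH k kj.
    rewrite -ltnS; apply: leq_trans hm; rewrite ltnS.
    case/andP: ik => /eqP E _; have hk := ymin_lt_ymax (X k).
    apply: proper_card; apply/fintype.properP; split.
      by apply/fintype.subsetP => z; rewrite !inE; lra.
    by exists k; rewrite !inE; lra.
  by exists (k :: p) => //=; rewrite pth andbT; apply/asboolP/(above_stepP tX).
elim: p i pth => [|k p IH] i /=; first by left.
move=> /andP[/asboolP/(above_stepP tX)/andP[_ ik] /IH h]; right; rewrite -/X in ik *.
case: h => [/eqP <- // | /and3P[h1 h2 h3]]; case/and3P: ik => h4 h5 h6.
by have hk := ymin_lt_ymax (X k); apply/and3P; split; rewrite -/X in h1 h2 h3 *; lra.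
Qed.

Lemma on_topE (R : realType) n (O : rectangle R) (X : 'I_n -> rectangle R)
    (tX : bottomed O X) i j :
  on_top X i j = under X i j && ~~ [exists k, under X i k && under X k j].
Proof.
apply/idP/andP => [/andP[/eqP E u] | [u]].
  split=> //; apply/existsPn => k; apply/negP => /andP[/and3P[h1 _ _] /and3P[h2 _ _]].
  by have := ymin_lt_ymax (X k); lra.
have [p ip /orP[/eqP <- // | pj]] := under_parent tX u.
by move=> /existsPn/(_ p); rewrite pj andbT; case/andP: ip => _ ->.
Qed.

Lemma contactP (R : realType) n (D : decomposition R n)
    (tX : bottomed (outer D) (rect D)) i j :
  contact D i j <-> [|| i == j, abut (rect D) i j, abut (rect D) j i,
    on_top (rect D) i j | on_top (rect D) j i].
Proof.
set X := rect D in tX *.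
have [[wi wj] [hi hj]] := ((xmin_lt_xmax (X i), xmin_lt_xmax (X j)),
  (ymin_lt_ymax (X i), ymin_lt_ymax (X j))).
have touching a b : ymax (X a) = ymin (X b) -> xmin (X a) < xmax (X b) ->
    xmin (X b) < xmax (X a) -> on_top X a b.
  move=> E h1 h2; have le : ymax (X a) <= ymin (X b) by rewrite E.
  have [h3 h4] := bottomed_below tX le h1 h2.
  by rewrite /on_top E eqxx /=; apply/and3P; split.
have floor a b : on_top X a b -> exists s, [/\ straight s, s `<=` boundary (X a) &
    s `<=` boundary (X b)].
  move=> /andP[/eqP E /and3P[_ h2 h3]]; have wa := xmin_lt_xmax (X a).
  exists (hline (ymax (X a)) (xmin (X a)) (xmax (X a))); split.
  - exact/straight_hline.
  - by apply/hline_sub_boundary => //; split=> //; right.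
  - by apply/hline_sub_boundary => //; split=> //; left.
have wall a b : abut X a b -> exists s, [/\ straight s, s `<=` boundary (X a) &
    s `<=` boundary (X b)].
  move=> /and3P[/eqP E h2 h3].
  have [ha hb] := (ymin_lt_ymax (X a), ymin_lt_ymax (X b)).
  have lt : Num.max (ymin (X a)) (ymin (X b)) < Num.min (ymax (X a)) (ymax (X b)).
    by case: (leP (ymin (X a)) (ymin (X b))); case: (leP (ymax (X a)) (ymax (X b))); lra.
  exists (vline (xmax (X a)) (Num.max (ymin (X a)) (ymin (X b)))
    (Num.min (ymax (X a)) (ymax (X b)))); split; first exact/straight_vline.
  - apply/vline_sub_boundary => //; split; first by right.
    by rewrite le_max ge_min !lexx; split.
  - apply/vline_sub_boundary => //; split; first by left.
    by rewrite le_max ge_min !lexx !orbT; split.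
split; last first.
  case/or4P=> [/eqP <- | /wall // | /wall [s [? ? ?]] | /orP[/floor // | /floor [s [? ? ?]]]].
  - exists (left_side (X i)); split; first exact/straight_vline.
      by apply/vline_sub_boundary => //; split=> //; left.
    by apply/vline_sub_boundary => //; split=> //; left.
  - by exists s.
  - by exists s.
move=> [s [[[a [c [d [cd ->]]]] | [b [e [f [ef ->]]]]]]].
  move=> /(vline_sub_boundary _ _ cd)[ai [h1 h2]] /(vline_sub_boundary _ _ cd)[aj [h3 h4]].
  rewrite -!/(X _) in ai aj h1 h2 h3 h4; case: ai aj => ai [] aj.
  - by rewrite (bottomed_apart tX (i := i) (j := j)) ?eqxx //; lra.
  - suff -> : abut X j i by rewrite !orbT.
    by apply/and3P; split; [apply/eqP| |]; lra.
  - suff -> : abut X i j by rewrite !orbT.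
    by apply/and3P; split; [apply/eqP| |]; lra.
  - by rewrite (bottomed_apart tX (i := i) (j := j)) ?eqxx //; lra.
move=> /(hline_sub_boundary _ _ ef)[bi [h1 h2]] /(hline_sub_boundary _ _ ef)[bj [h3 h4]].
rewrite -!/(X _) in bi bj h1 h2 h3 h4; case: bi bj => bi [] bj.
- by rewrite (bottomed_apart tX (i := i) (j := j)) ?eqxx //; lra.
- by rewrite (touching j i) ?orbT //; lra.
- by rewrite (touching i j) ?orbT //; lra.
- by rewrite (bottomed_apart tX (i := i) (j := j)) ?eqxx //; lra.
Qed.

Lemma left_of_relE (R : realType) n (D : decomposition R n)
    (tX : bottomed (outer D) (rect D)) i j :
  left_of (rect D) i j = (i != j) && right_of D i j.
Proof.
by rewrite right_ofP //; case: eqVneq => [-> | _] //=; exact: left_ofxx.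
Qed.

Lemma under_relE (R : realType) n (D : decomposition R n)
    (tX : bottomed (outer D) (rect D)) i j :
  under (rect D) i j = (i != j) && above D i j.
Proof. by rewrite aboveP //; case: eqVneq => [-> | _] //=; exact: underxx. Qed.

(** A contact says neither which way it runs nor on which side it lies. Rectangles on top of one
    another overlap in width, so [right_of] singles out the vertical contacts and orients them. *)
Lemma abut_relP (R : realType) n (D : decomposition R n)
    (tX : bottomed (outer D) (rect D)) i j :
  abut (rect D) i j <-> [/\ i != j, right_of D i j & contact D i j].
Proof.
set X := rect D in tX *; have [wi wj] := (xmin_lt_xmax (X i), xmin_lt_xmax (X j)).
split=> [ab | [ij ro /(contactP tX)]].
  have ij : i != j by apply/eqP => E; rewrite E abutxx in ab.
  split=> //; last by apply/(contactP tX); rewrite ab orbT.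
  by rewrite right_ofP //; case/and3P: ab => /eqP E _ _; rewrite /left_of -/X E lexx orbT.
have : left_of X i j by rewrite left_of_relE // ij.
rewrite /left_of (negbTE ij) /= => lij.
case/or4P=> [// | /and3P[/eqP E _ _] | /andP[_ /and3P[_ h2 h3]] | /andP[_ /and3P[_ h2 h3]]];
  by rewrite -!/(X _) in lij *; try rewrite -!/(X _) in E; exfalso; lra.
Qed.

Lemma strong_equivP (R : realType) n (D D' : rectangulation R n)
    (tX : bottomed (outer D) (rect D)) (tX' : bottomed (outer D') (rect D')) :
  strong_equiv D D' <-> exists f, same_shape (rect D) (rect D') f.
Proof.
split=> [[f fbij rel] | [f s]]; exists f.
- have finj := bij_inj fbij.
  have ro i j : right_of D' (f i) (f j) = right_of D i j.
    by apply/idP/idP; case: (rel i j) => h _ _; apply h.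
  have ab i j : above D' (f i) (f j) = above D i j.
    by apply/idP/idP; case: (rel i j) => _ h _; apply h.
  split=> // i j.
  + by rewrite !left_of_relE // (inj_eq finj) ro.
  + by rewrite !under_relE // (inj_eq finj) ab.
  + apply/idP/idP => /abut_relP[] // h1 h2 h3; apply/abut_relP => //.
      by split; [rewrite -(inj_eq finj) | rewrite -ro | case: (rel i j) => _ _ ->].
    by split; [rewrite (inj_eq finj) | rewrite ro | case: (rel i j) => _ _ <-].
- exact: injF_bij (same_inj s).
- have on_top_same i j : on_top (rect D') (f i) (f j) = on_top (rect D) i j.
    rewrite !(on_topE tX) !(on_topE tX') (same_under s); congr (_ && ~~ _).
    by apply: (exists_same_shape s) => k; rewrite !(same_under s).
  move=> i j; split.
  + by rewrite !right_ofP // (inj_eq (same_inj s)) (same_left_of s).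
  + by rewrite !aboveP // (inj_eq (same_inj s)) (same_under s).
  + rewrite !contactP // (inj_eq (same_inj s)) !(same_abut s) !on_top_same.
    exact: iff_refl.
Qed.

(** * Strong classes and the final bijection *)

Lemma strong_equiv_sym (R : realType) n (D D' : rectangulation R n) :
  strong_equiv D D' -> strong_equiv D' D.
Proof.
move=> [f [g fK gK] rel]; exists g; first by exists f.
move=> i j; have := rel (g i) (g j); rewrite !gK => -[r1 r2 r3].
by split; apply: iff_sym.
Qed.

Lemma strong_equiv_trans (R : realType) n (D1 D2 D3 : rectangulation R n) :
  strong_equiv D1 D2 -> strong_equiv D2 D3 -> strong_equiv D1 D3.
Proof.
move=> [f fb relf] [g gb relg]; exists (g \o f); first exact: bij_comp.
move=> i j; have [f1 f2 f3] := relf i j; have [g1 g2 g3] := relg (f i) (f j).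
by split; apply: iff_trans; eassumption.
Qed.

Lemma strong_class_eq (R : realType) n (D D' : rectangulation R n) :
  strong_class D = strong_class D' <-> strong_equiv D D'.
Proof.
split=> [E | DD'].
  have : strong_class D' D' by exists id; [exists id | move=> i j; split].
  by rewrite -E.
apply/seteqP; split=> D'' /= h; last exact: strong_equiv_trans h.
exact: strong_equiv_trans (strong_equiv_sym DD') h.
Qed.

Lemma strong_class_coded (R : realType) n (D D' : rectangulation R n.+1) w w' :
  verticals_on_bottom D -> verticals_on_bottom D' ->
  coded (outer D) (rect D) w -> coded (outer D') (rect D') w' ->
  strong_class D = strong_class D' <-> w = w'.
Proof.
move=> /bottomed_of_decomposition tD /bottomed_of_decomposition tD' cw cw'.
apply: (iff_trans (strong_class_eq D D')); apply: (iff_trans (strong_equivP tD tD')).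
split=> [[f s] | ww']; first exact: coded_uniq tD tD' s cw cw'.
by apply: (coded_same_shape tD tD' cw); rewrite ww'.
Qed.

Theorem theorem6 (R : realType) (n : nat) (hn : (1 <= n)%N) :
  (strong_rectangulations_bot R n #= I_011_201 n)%card.
Proof.
case: n hn => // n _.
pose Q (e : n.+1.-tuple nat) (C : set (rectangulation R n.+1)) :=
  exists (D : rectangulation R n.+1) w, [/\ verticals_on_bottom D, C = strong_class D,
    coded (outer D) (rect D) w, valid w & decode w = e].
have codeP (D : rectangulation R n.+1) : verticals_on_bottom D ->
    exists w, [/\ coded (outer D) (rect D) w, valid w & size w = n].
  move=> /bottomed_of_decomposition tD; have [w cw] := coded_exists tD.
  by exists w; have [] := coded_valid tD cw.
(* The map goes from sequences to classes, realizing the decoded word inside the unit square;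
   sequences outside the set get an arbitrary value. *)
have /choice[Phi PhiP] e : exists C, I_011_201 n.+1 e -> Q e C.
  have [/I_011_201P g | ne] := pselect (I_011_201 n.+1 e); last first.
    by exists set0 => /ne.
  have [w [szw vw dw]] := decode_onto (size_tuple e) g.
  pose O := Rectangle (@ltr01 R) (@ltr01 R).
  have [X tX cX] := coded_realize O szw vw.
  have [D [oD rD vob]] := rectangulation_of_bottomed tX.
  by exists (strong_class D) => _; exists D, w; split=> //; rewrite oD rD.
have -> : strong_rectangulations_bot R n.+1 = Phi @` I_011_201 n.+1.
  apply/seteqP; split=> [C [D vob <-] | C [e Ie <-]]; last first.
    by have [D [w [vob -> _ _ _]]] := PhiP e Ie; exists D.
  have [w [cw vw szw]] := codeP D vob.
  have [sz g _] := decode_valid vw; rewrite szw in sz.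
  have Ie : I_011_201 n.+1 (Tuple (introT eqP sz)) by apply/I_011_201P.
  exists (Tuple (introT eqP sz)) => //.
  have [D' [w' [vob' -> cw' vw' dw']]] := PhiP _ Ie.
  by apply/(strong_class_coded vob' vob cw' cw); exact: decode_inj dw'.
apply: inj_card_eq => e e' /set_mem Ie /set_mem Ie' E.
have [D [w [vob CE cw vw dw]]] := PhiP e Ie.
have [D' [w' [vob' CE' cw' vw' dw']]] := PhiP e' Ie'.
rewrite CE CE' in E; apply: val_inj; rewrite /= -dw -dw'; congr decode.
exact/(strong_class_coded vob vob' cw cw').
Qed.
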